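(* Given perturbation data $\pi=(P,f,\epsilon)$, the restriction map to the pillowcase $$R^\natural_{(P,f,\epsilon)}(B^3,A_1\cup A_2)\to R(S^2,\{a,b,c,d\})$$ is an immersion of the circle $\{\rho^\epsilon(\beta)\mid\beta\in\mathbb{R}/2\pi\mathbb{Z}\}$ for $\epsilon>0$ small. Its image is the image of the curve in $\mathbb{R}^2$, $\beta\mapsto(\beta+\epsilon f(\beta)+\tfrac\pi2,\ \beta-\epsilon f(\beta)+\tfrac\pi2)$, under the canonical projection of $\mathbb{R}^2$ to the pillowcase. The limit $$\lim_{\epsilon\to0}R^\natural_{(P,f,\epsilon)}(B^3,A_1\cup A_2)\subset R^\natural(B^3,A_1\cup A_2)$$ is a circle consisting of those representations which send $h$ to $\pm\mathbf j$, i.e. those points with $\tau\in\{0,\pi\}$ in the cylindrical coordinates $(\gamma,\tau)$ on the 2-sphere $R^\natural(B^3,A_1\cup A_2)$. Its projection to the pillowcase is a map from the circle onto the diagonal $\beta\mapsto(\beta+\tfrac\pi2,\beta+\tfrac\pi2)$, which is a 2-1 immersion except at the corners when $\beta=\tfrac\pi2$ and $\tfrac{3\pi}2$.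
   Context: Notation. $SU(2)$ is identified with the unit quaternions; $C(\mathbf i)$ is the set of pure (traceless) unit quaternions; $e^{tQ}=\cos t+\sin t\,Q$ for $Q\in C(\mathbf i)$. Bars denote inverses and $[x,y]=xy\bar x\bar y$. Pillowcase. $R(S^2,\{a,b,c,d\})$ is the space of conjugacy classes of homomorphisms $\langle a,b,c,d\mid ba=cd\rangle\to SU(2)$ sending each generator into $C(\mathbf i)$, identified with $\mathbb{R}^2/\sim$, $(\gamma,\theta)\sim(-\gamma,-\theta)\sim(\gamma+2\pi m,\theta+2\pi n)$, by $(\gamma,\theta)\leftrightarrow[a\mapsto\mathbf i,b\mapsto e^{\gamma\mathbf k}\mathbf i,c\mapsto e^{\theta\mathbf k}\mathbf i,d\mapsto e^{(\theta-\gamma)\mathbf k}\mathbf i]$. The four images of $(\pi\mathbb{Z})^2$ are the corners; away from them the pillowcase is a smooth surface, and an immersion into the pillowcase is a map avoiding the corners that is a smooth immersion there. Moduli spaces. $A_1\cup A_2\subset B^3$ is a pair of unknotted arcs, $H$ a small meridian circle of $A_1$, $W$ a short arc joining $H$ to $A_1$, and $P$ an unknotted circle linking $A_2$ and $H$. With $a,b,c,d$ meridians of the endpoints of the arcs, $h,w,p$ meridians of $H,W,P$, and longitude $\lambda_P=bh$, $$\pi_1(B^3\setminus(A_1\cup A_2\cup H\cup W\cup P))=\langle a,b,c,d,h,w,p\mid c=\bar pbp,\ d=\bar cba,\ [bh,p]=1,\ [a\bar p,h]=(ha)w(\bar a\bar h)\rangle .$$ $f:\mathbb{R}\to\mathbb{R}$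 is smooth, odd, $2\pi$-periodic, $|f|\le1$, and $f(x)\ne0$ unless $x\in\pi\mathbb{Z}$. For $\epsilon\ge0$, $R^\natural_{(P,f,\epsilon)}(B^3,A_1\cup A_2)$ is the space of conjugacy classes of homomorphisms of this group to $SU(2)$ sending $a,b,c,d,h$ into $C(\mathbf i)$, $w$ to $-1$, and such that $p\mapsto e^{\epsilon f(\beta)Q}$ whenever $\lambda_P\mapsto e^{\beta Q}$, $Q\in C(\mathbf i)$. For $\epsilon=0$ (so $p\mapsto1$) this is $R^\natural(B^3,A_1\cup A_2)$, a 2-sphere with cylindrical coordinates $(\gamma,\tau)\in[0,\pi]\times[0,2\pi]$ given by $a\mapsto\mathbf i,\ b\mapsto e^{\gamma\mathbf k}\mathbf i,\ c\mapsto e^{\gamma\mathbf k}\mathbf i,\ d\mapsto\mathbf i,\ h\mapsto e^{\tau\mathbf i}\mathbf j,\ w\mapsto-1$. For $\epsilon>0$ small, the space is the circle of classes $\rho^\epsilon(\beta)$, $\beta\in\mathbb{R}/2\pi\mathbb{Z}$: $$a\mapsto\mathbf i,\ b\mapsto e^{(\frac\pi2+\beta+\epsilon f(\beta))\mathbf k}\mathbf i,\ c\mapsto e^{(\frac\pi2+\beta-\epsilon f(\beta))\mathbf k}\mathbf i,\ d\mapsto e^{-2\epsilon f(\beta)\mathbf k}\mathbf i,\ h\mapsto-\mathbf je^{-\epsilon f(\beta)\mathbf k},\ p\mapsto e^{\epsilon f(\beta)\mathbf k},\ w\mapsto-1 .$$ The limit as $\epsilon\to0$ means the set of classes $\lim_{\epsilon\to0}\rho^\epsilon(\beta)$,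 $\beta\in\mathbb{R}/2\pi\mathbb{Z}$. *)

(* Defs.v *)
From Stdlib Require Import Reals List.
From Coquelicot Require Import Coquelicot.
Import ListNotations.
Open Scope R_scope.

(** * Quaternions *)

(* (x0, x1, x2, x3) stands for x0 + x1 i + x2 j + x3 k. *)
Definition quat : UniformSpace :=
  prod_UniformSpace
    (prod_UniformSpace (prod_UniformSpace R_UniformSpace R_UniformSpace)
       R_UniformSpace)
    R_UniformSpace.

Definition mkq (x0 x1 x2 x3 : R) : quat := (x0, x1, x2, x3).

Definition qmul (x y : quat) : quat :=
  let '(x0, x1, x2, x3) := x in
  let '(y0, y1, y2, y3) := y in
  mkq (x0 * y0 - x1 * y1 - x2 * y2 - x3 * y3)
      (x0 * y1 + x1 * y0 + x2 * y3 - x3 * y2)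
      (x0 * y2 - x1 * y3 + x2 * y0 + x3 * y1)
      (x0 * y3 + x1 * y2 - x2 * y1 + x3 * y0).

Definition qconj (x : quat) : quat :=
  let '(x0, x1, x2, x3) := x in mkq x0 (- x1) (- x2) (- x3).

Definition qopp (x : quat) : quat :=
  let '(x0, x1, x2, x3) := x in mkq (- x0) (- x1) (- x2) (- x3).

Definition qone : quat := mkq 1 0 0 0.
Definition qi : quat := mkq 0 1 0 0.
Definition qj : quat := mkq 0 0 1 0.
Definition qk : quat := mkq 0 0 0 1.

Definition SU2 (x : quat) : Prop :=
  let '(x0, x1, x2, x3) := x in x0 ^ 2 + x1 ^ 2 + x2 ^ 2 + x3 ^ 2 = 1.

(* The conjugacy class C(i) of i. *)
Definition pure_unit (x : quat) : Prop :=
  SU2 x /\ (let '(x0, _, _, _) := x in x0 = 0).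

(* e^{tQ} = cos t + sin t Q, for Q a pure unit quaternion. *)
Definition qexp (t : R) (Q : quat) : quat :=
  let '(q0, q1, q2, q3) := Q in
  mkq (cos t + sin t * q0) (sin t * q1) (sin t * q2) (sin t * q3).

(** * Homomorphisms from a finitely presented group to SU(2) *)

Inductive word (X : Type) : Type :=
| One : word X
| Gen : X -> word X
| Mul : word X -> word X -> word X
| Inv : word X -> word X.
Arguments One {X}.
Arguments Gen {X} _.
Arguments Mul {X} _ _.
Arguments Inv {X} _.

Definition Comm {X : Type} (u v : word X) : word X :=
  Mul (Mul (Mul u v) (Inv u)) (Inv v).

(* On unit quaternions the inverse is the quaternionic conjugate. *)
Fixpoint eval {X : Type} (rho : X -> quat) (u : word X) : quat :=
  match u with
  | One => qone
  | Gen x => rho x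
  | Mul v w => qmul (eval rho v) (eval rho w)
  | Inv v => qconj (eval rho v)
  end.

(* A homomorphism <X | rels> -> SU(2) is given by the images of the generators,
   subject to the relations [u = v] for each pair (u, v) of rels. *)
Definition hom {X : Type} (rels : list (word X * word X)) (rho : X -> quat) :
    Prop :=
  (forall x, SU2 (rho x)) /\
  (forall u v, In (u, v) rels -> eval rho u = eval rho v).

Definition conjugate {X : Type} (rho rho' : X -> quat) : Prop :=
  exists g : quat, SU2 g /\ forall x, rho' x = qmul (qmul g (rho x)) (qconj g).

(* A conjugacy class is represented by the set of its members, so that equality
   of classes is equality of sets. *)
Definition conj_class (X : Type) : Type := (X -> quat) -> Prop.

Definition cls {X : Type} (rho : X -> quat) : conj_class X := conjugate rho.

Definition class_space {X : Type} (rels : list (word X * word X))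
    (x : conj_class X) : Prop :=
  exists rho, hom rels rho /\ x = cls rho.

(* Open sets for the quotient topology on [class_space rels]: the homomorphisms
   are topologized as a subspace of the product of copies of the quaternions
   (X is finite in all uses, so that fct_UniformSpace is the product). *)
Definition open_classes {X : Type} (rels : list (word X * word X))
    (U : conj_class X -> Prop) : Prop :=
  exists V : fct_UniformSpace X quat -> Prop,
    open V /\ forall rho, hom rels rho -> (U (cls rho) <-> V rho).

(* Convergence x_e -> x as e -> 0, e > 0, in [class_space rels]. *)
Definition class_lim0 {X : Type} (rels : list (word X * word X))
    (x_ : R -> conj_class X) (x : conj_class X) : Prop :=
  class_space rels x /\
  forall U, open_classes rels U -> U x -> at_right 0 (fun e => U (x_ e)).

Definition cong2pi (b b' : R) : Prop := exists m : Z, b' = b + 2 * PI * IZR m.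

(* phi induces a homeomorphism from R/2piZ onto the subspace S of
   [class_space rels]; the open sets of R/2piZ are the 2pi-periodic open sets
   of R. *)
Definition circle_param {X : Type} (rels : list (word X * word X))
    (S : conj_class X -> Prop) (phi : R -> conj_class X) : Prop :=
  (forall x, S x <-> exists b, x = phi b) /\
  (forall b b', phi b = phi b' <-> cong2pi b b') /\
  (forall D : R -> Prop, (forall b b', cong2pi b b' -> (D b <-> D b')) ->
     (open D <->
      exists U, open_classes rels U /\ forall b, D b <-> U (phi b))).

(** * The pillowcase *)

Inductive sgen : Type := sa | sb | sc | sd.

(* ba = cd *)
Definition sphere_rels : list (word sgen * word sgen) :=
  [(Mul (Gen sb) (Gen sa), Mul (Gen sc) (Gen sd))].

Definition R_sphere (y : conj_class sgen) : Prop :=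
  exists sigma, hom sphere_rels sigma /\ (forall s, pure_unit (sigma s)) /\
                y = cls sigma.

Definition pillow_rep (gamma theta : R) (s : sgen) : quat :=
  match s with
  | sa => qi
  | sb => qmul (qexp gamma qk) qi
  | sc => qmul (qexp theta qk) qi
  | sd => qmul (qexp (theta - gamma) qk) qi
  end.

(* The canonical projection R^2 -> R^2/~, with R^2/~ identified with R_sphere. *)
Definition pillow (gamma theta : R) : conj_class sgen :=
  cls (pillow_rep gamma theta).

Definition corner (y : conj_class sgen) : Prop :=
  exists m n : Z, y = pillow (IZR m * PI) (IZR n * PI).

(* Away from the corners [pillow] is a covering map, whose local inverses are
   the charts of the smooth structure.  So a map g to the pillowcase is a smooth
   immersion at b when g b is not a corner and, near b, g has a smooth lift to
   R^2 with nonzero derivative at b. *)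
Definition pillow_immersion_at (g : R -> conj_class sgen) (b : R) : Prop :=
  ~ corner (g b) /\
  exists gamma theta : R -> R,
    locally b (fun t => g t = pillow (gamma t) (theta t) /\
                        forall n, ex_derive_n gamma n t /\
                                  ex_derive_n theta n t) /\
    (Derive gamma b <> 0 \/ Derive theta b <> 0).

(** * The perturbed tangle *)

Inductive tgen : Type := ta | tb | tc | td | th | tw | tp.

Definition lambda_P : word tgen := Mul (Gen tb) (Gen th).

(* c = p^-1 b p,  d = c^-1 b a,  [bh, p] = 1,
   [a p^-1, h] = (h a) w (a^-1 h^-1) *)
Definition tangle_rels : list (word tgen * word tgen) :=
  [ (Gen tc, Mul (Mul (Inv (Gen tp)) (Gen tb)) (Gen tp));
    (Gen td, Mul (Mul (Inv (Gen tc)) (Gen tb)) (Gen ta));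
    (Comm lambda_P (Gen tp), One);
    (Comm (Mul (Gen ta) (Inv (Gen tp))) (Gen th),
     Mul (Mul (Mul (Gen th) (Gen ta)) (Gen tw))
         (Mul (Inv (Gen ta)) (Inv (Gen th)))) ].

Definition perturbation_function (f : R -> R) : Prop :=
  (forall n x, ex_derive_n f n x) /\
  (forall x, f (- x) = - f x) /\
  (forall x, f (x + 2 * PI) = f x) /\
  (forall x, Rabs (f x) <= 1) /\
  (forall x, f x = 0 -> exists n : Z, x = IZR n * PI).

Definition nat_rep (f : R -> R) (eps : R) (rho : tgen -> quat) : Prop :=
  hom tangle_rels rho /\
  pure_unit (rho ta) /\ pure_unit (rho tb) /\ pure_unit (rho tc) /\
  pure_unit (rho td) /\ pure_unit (rho th) /\
  rho tw = qopp qone /\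
  (forall (beta : R) (Q : quat), pure_unit Q ->
     eval rho lambda_P = qexp beta Q -> rho tp = qexp (eps * f beta) Q).

(* For eps = 0 this is the unperturbed space, with p sent to 1 (every unit
   quaternion is some e^{beta Q}), whatever f is. *)
Definition R_nat (f : R -> R) (eps : R) (x : conj_class tgen) : Prop :=
  exists rho, nat_rep f eps rho /\ x = cls rho.

Definition rho_eps (f : R -> R) (eps beta : R) (t : tgen) : quat :=
  match t with
  | ta => qi
  | tb => qmul (qexp (PI / 2 + beta + eps * f beta) qk) qi
  | tc => qmul (qexp (PI / 2 + beta - eps * f beta) qk) qi
  | td => qmul (qexp (- (2 * eps * f beta)) qk) qi
  | th => qmul (qopp qj) (qexp (- (eps * f beta)) qk)
  | tw => qopp qone
  | tp => qexp (eps * f beta) qk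
  end.

(* Cylindrical coordinates on the 2-sphere [R_nat f 0]. *)
Definition cyl_rep (gamma tau : R) (t : tgen) : quat :=
  match t with
  | ta => qi
  | tb => qmul (qexp gamma qk) qi
  | tc => qmul (qexp gamma qk) qi
  | td => qi
  | th => qmul (qexp tau qi) qj
  | tw => qopp qone
  | tp => qone
  end.

(* The limit of the circles [R_nat f eps] as eps -> 0. *)
Definition R_lim (f : R -> R) (x : conj_class tgen) : Prop :=
  exists beta, class_lim0 tangle_rels (fun eps => cls (rho_eps f eps beta)) x.

Definition sphere_incl (s : sgen) : tgen :=
  match s with sa => ta | sb => tb | sc => tc | sd => td end.

Definition restrict (x : conj_class tgen) : conj_class sgen :=
  fun sigma => exists rho, x rho /\ forall s, sigma s = rho (sphere_incl s).

(* Main.v *)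
Require Import Defs.
From Stdlib Require Import Reals ZArith Lra Lia FunctionalExtensionality PropExtensionality.
From Coquelicot Require Import Coquelicot.
Open Scope R_scope.

(* Every [rho_eps f eps beta] takes its values in the group { e^{tk}, e^{tk} i }, where the
   relations reduce to identities between angles mod 2 pi.  Conversely, given a point of
   [R_nat f eps], write lambda_P = e^{beta Q}: then p = e^{eps f(beta) Q}, and w = -1 makes
   x = a p^-1 anticommute with h.  Hence x is pure and orthogonal to h.  If sin beta <> 0, purity
   of x gives a _|_ Q, and conjugating (a, Q) to (i, k) pins down h up to a sign, which
   conjugation by i absorbs into beta -> - beta; if sin beta = 0, then p = 1 and a _|_ h.
   The class functions Re(lambda_P) = cos beta and Re(a p^-1 h lambda_P) = sin beta recover beta
   and give the homeomorphism with the circle.  Real parts of words separate the limit points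
   from all other classes, so limits are unique.  On the pillowcase, Re(ab) and Re(ac) are
   - cos gamma and - cos theta, which detects corners and double points. *)

(** * Quaternions *)

Definition re (x : quat) : R := fst (fst (fst x)).
Definition im1 (x : quat) : R := snd (fst (fst x)).
Definition im2 (x : quat) : R := snd (fst x).
Definition im3 (x : quat) : R := snd x.

Definition conj_by (g x : quat) : quat := qmul (qmul g x) (qconj g).

Lemma mkq_eq (x0 x1 x2 x3 y0 y1 y2 y3 : R) :
  x0 = y0 -> x1 = y1 -> x2 = y2 -> x3 = y3 -> mkq x0 x1 x2 x3 = mkq y0 y1 y2 y3.
Proof. intros; subst; reflexivity. Qed.

Ltac qunfold :=
  repeat match goal with
    | x : UniformSpace.sort quat |- _ => destruct x as [[[? ?] ?] ?]
    end;
  repeat match goal with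
    | x : UniformSpace.sort R_UniformSpace |- _ => change R in (type of x)
    end;
  cbv beta iota delta [conj_by qone qopp qi qj qk qexp qmul qconj mkq re im1 im2 im3
                       fst snd SU2 pure_unit] in *.

Ltac qring := intros; qunfold; first [apply mkq_eq; ring | ring].

Lemma qmul_assoc (x y z : quat) : qmul (qmul x y) z = qmul x (qmul y z).
Proof. qring. Qed.

Lemma qmul_1l (x : quat) : qmul qone x = x.
Proof. qring. Qed.

Lemma qmul_1r (x : quat) : qmul x qone = x.
Proof. qring. Qed.

Lemma qmul_oppl (x y : quat) : qmul (qopp x) y = qopp (qmul x y).
Proof. qring. Qed.

Lemma qmul_oppr (x y : quat) : qmul x (qopp y) = qopp (qmul x y).
Proof. qring. Qed.

Lemma qconj_mul (x y : quat) : qconj (qmul x y) = qmul (qconj y) (qconj x).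
Proof. qring. Qed.

Lemma qconj_conj (x : quat) : qconj (qconj x) = x.
Proof. qring. Qed.

Lemma qmul_conj_r (x : quat) : SU2 x -> qmul x (qconj x) = qone.
Proof. intros H; qunfold; apply mkq_eq; nra. Qed.

Lemma qmul_conj_l (x : quat) : SU2 x -> qmul (qconj x) x = qone.
Proof. intros H; qunfold; apply mkq_eq; nra. Qed.

Lemma qmul_conjK (x y : quat) : SU2 y -> qmul (qmul x y) (qconj y) = x.
Proof. intros H; rewrite qmul_assoc, qmul_conj_r, qmul_1r; trivial. Qed.

Lemma SU2_mul (x y : quat) : SU2 x -> SU2 y -> SU2 (qmul x y).
Proof.
intros Hx Hy; qunfold.
match goal with |- ?l = 1 => match type of Hx with ?a = _ => match type of Hy with ?b = _ =>
  replace l with (a * b) by ring end end end.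
rewrite Hx, Hy; ring.
Qed.

Lemma SU2_conj (x : quat) : SU2 x -> SU2 (qconj x).
Proof. intros H; qunfold; nra. Qed.

Lemma SU2_one : SU2 qone.
Proof. qunfold; ring. Qed.

Lemma conj_by_mul (g x y : quat) :
  SU2 g -> qmul (conj_by g x) (conj_by g y) = conj_by g (qmul x y).
Proof.
intros H; unfold conj_by; rewrite !qmul_assoc; do 2 f_equal.
rewrite <- (qmul_assoc (qconj g) g), qmul_conj_l, qmul_1l; trivial.
Qed.

Lemma conj_by_conj (g x : quat) : qconj (conj_by g x) = conj_by g (qconj x).
Proof. qring. Qed.

Lemma conj_by_one (g : quat) : SU2 g -> conj_by g qone = qone.
Proof. intros H; unfold conj_by; rewrite qmul_1r; apply qmul_conj_r, H. Qed.

Lemma conj_one_by (x : quat) : conj_by qone x = x.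
Proof. qring. Qed.

Lemma conj_by_comp (g h x : quat) : conj_by g (conj_by h x) = conj_by (qmul g h) x.
Proof. qring. Qed.

Lemma conj_byK (g x : quat) : SU2 g -> conj_by (qconj g) (conj_by g x) = x.
Proof.
intros H; rewrite conj_by_comp, qmul_conj_l by trivial; unfold conj_by; qring.
Qed.

Lemma SU2_conj_by (g x : quat) : SU2 g -> SU2 x -> SU2 (conj_by g x).
Proof. intros; apply SU2_mul; [apply SU2_mul | apply SU2_conj]; trivial. Qed.

(** Conjugation multiplies the real part by the squared norm of [g]. *)
Lemma re_conj_by (g x : quat) : SU2 g -> re (conj_by g x) = re x.
Proof.
intros H; qunfold.
match goal with |- _ = ?r => transitivity (1 * r); [rewrite <- H|]; ring end.
Qed.

Lemma pure_unitP (x : quat) : pure_unit x <-> SU2 x /\ re x = 0.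
Proof. qunfold; tauto. Qed.

Lemma pure_conj_by (g x : quat) : SU2 g -> pure_unit x -> pure_unit (conj_by g x).
Proof.
rewrite !pure_unitP; intros H [H1 H2]; split;
  [apply SU2_conj_by | rewrite re_conj_by]; trivial.
Qed.

Lemma qexp_conj_by (g Q : quat) (t : R) :
  SU2 g -> conj_by g (qexp t Q) = qexp t (conj_by g Q).
Proof.
intros H.
(* Linearity in 1 and [Q]: with g 1 g^-1 kept symbolic this is a polynomial identity, and the norm
   of [g] enters only through [conj_by_one]. *)
assert (E : conj_by g (qexp t Q) =
  let '(q0, q1, q2, q3) := conj_by g Q in let '(o0, o1, o2, o3) := conj_by g qone in
  mkq (cos t * o0 + sin t * q0) (cos t * o1 + sin t * q1)
      (cos t * o2 + sin t * q2) (cos t * o3 + sin t * q3)) by qring.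
rewrite E, conj_by_one by trivial; destruct (conj_by g Q) as [[[? ?] ?] ?].
qring.
Qed.

(** * Moving pure unit quaternions into standard position *)

Lemma qi_pure : pure_unit qi.
Proof. qunfold; split; [ring | exact Ropp_0 || reflexivity]. Qed.
Lemma qj_opp_pure : pure_unit (qopp qj).
Proof. qunfold; split; [ring | exact Ropp_0 || reflexivity]. Qed.
Lemma qk_pure : pure_unit qk.
Proof. qunfold; split; [ring | exact Ropp_0 || reflexivity]. Qed.

(* [g] is a multiple of [1 - z x], which satisfies [(1 - z x) x = x + z = z (1 - z x)]. *)
Lemma pure_transport (x z : quat) : pure_unit x -> pure_unit z -> z <> qopp x ->
  exists c : R,
    let g := let '(y0, y1, y2, y3) := qmul z x in
             mkq (c * (1 - y0)) (- (c * y1)) (- (c * y2)) (- (c * y3)) in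
    SU2 g /\ conj_by g x = z.
Proof.
destruct x as [[[x0 x1] x2] x3]; destruct z as [[[z0 z1] z2] z3].
intros [Hx Hx0] [Hz Hz0] Hne; cbv beta iota delta [SU2] in Hx, Hx0, Hz, Hz0; subst x0 z0.
(* [D] is both |x + z|^2 and |1 - z x|^2; it vanishes only for z = - x, and c = 1 / sqrt D
   normalizes 1 - z x. *)
set (D := 2 + 2 * (x1 * z1 + x2 * z2 + x3 * z3)).
assert (ED : (x1 + z1) ^ 2 + (x2 + z2) ^ 2 + (x3 + z3) ^ 2 = D) by (unfold D; nra).
assert (HD : 0 < D).
{ destruct (Rlt_or_le 0 D) as [h|h]; trivial; exfalso; apply Hne.
  pose proof (pow2_ge_0 (x1 + z1)); pose proof (pow2_ge_0 (x2 + z2));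
  pose proof (pow2_ge_0 (x3 + z3)).
  assert (x1 + z1 = 0) by (apply Rsqr_0_uniq; unfold Rsqr; nra).
  assert (x2 + z2 = 0) by (apply Rsqr_0_uniq; unfold Rsqr; nra).
  assert (x3 + z3 = 0) by (apply Rsqr_0_uniq; unfold Rsqr; nra).
  unfold qopp; apply mkq_eq; lra. }
exists (/ sqrt D); set (c := / sqrt D).
assert (Hc : c * c * D = 1).
{ unfold c; rewrite <- (sqrt_sqrt D) at 3 by lra; field.
  apply Rgt_not_eq, sqrt_lt_R0, HD. }
intros g.
assert (Hg : SU2 g).
{ unfold g; clear g Hne; qunfold.
  assert (E : (x1 ^ 2 + x2 ^ 2 + x3 ^ 2) * (z1 ^ 2 + z2 ^ 2 + z3 ^ 2) = 1) by
    (replace (x1 ^ 2 + x2 ^ 2 + x3 ^ 2) with 1 by lra;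
     replace (z1 ^ 2 + z2 ^ 2 + z3 ^ 2) with 1 by lra; ring).
  transitivity (c * c *
    (1 + 2 * (x1 * z1 + x2 * z2 + x3 * z3) +
     (x1 ^ 2 + x2 ^ 2 + x3 ^ 2) * (z1 ^ 2 + z2 ^ 2 + z3 ^ 2)));
    [ring | rewrite E; transitivity (c * c * D); [unfold D; ring | exact Hc]]. }
split; [exact Hg|].
assert (E : qmul g (0, x1, x2, x3) = qmul (0, z1, z2, z3) g).
{ unfold g; clear g Hg Hne; qunfold.
  (* The imaginary parts of the two sides expand to c (x + |x|^2 z) and c (z + |z|^2 x), which agree
     because both norms are 1. *)
  apply mkq_eq; [ring | | |];
  [ transitivity (c * (x1 + z1 * (0 ^ 2 + x1 ^ 2 + x2 ^ 2 + x3 ^ 2)));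
    [ring | rewrite Hx; transitivity (c * (z1 + x1 * (0 ^ 2 + z1 ^ 2 + z2 ^ 2 + z3 ^ 2)));
     [rewrite Hz|]; ring]
  | transitivity (c * (x2 + z2 * (0 ^ 2 + x1 ^ 2 + x2 ^ 2 + x3 ^ 2)));
    [ring | rewrite Hx; transitivity (c * (z2 + x2 * (0 ^ 2 + z1 ^ 2 + z2 ^ 2 + z3 ^ 2)));
     [rewrite Hz|]; ring]
  | transitivity (c * (x3 + z3 * (0 ^ 2 + x1 ^ 2 + x2 ^ 2 + x3 ^ 2)));
    [ring | rewrite Hx; transitivity (c * (z3 + x3 * (0 ^ 2 + z1 ^ 2 + z2 ^ 2 + z3 ^ 2)));
     [rewrite Hz|]; ring] ]. }
transitivity (qmul (qmul (0, z1, z2, z3) g) (qconj g));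
  [exact (f_equal (fun u => qmul u (qconj g)) E) | apply qmul_conjK, Hg].
Qed.

(** First [x] is moved to i, then [y] is rotated to [z] in the plane orthogonal to i by an element
    commuting with i. The antipodal cases excluded by [pure_transport] are settled by j, which sends
    - i to i, and by i, which negates that plane. *)
Lemma frame_transport (x y z : quat) :
  pure_unit x -> pure_unit y -> re (qmul x y) = 0 -> pure_unit z -> im1 z = 0 ->
  exists g, SU2 g /\ conj_by g x = qi /\ conj_by g y = z.
Proof.
intros Hx Hy Hxy Hz Hz1.
assert (H1 : exists g, SU2 g /\ conj_by g x = qi).
{ destruct (Classical_Prop.classic (qi = qopp x)) as [e|ne].
  - exists qj; split; [qunfold; ring|].
    replace x with (qopp qi) by (rewrite e; qring); qring.
  - destruct (pure_transport x qi Hx qi_pure ne) as [c [h1 h2]]; eexists; split; eassumption. }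
destruct H1 as [g [Hg Hgx]].
assert (Hy' : pure_unit (conj_by g y)) by (apply pure_conj_by; trivial).
assert (Hp : im1 (conj_by g y) = 0).
{ rewrite <- (re_conj_by g) in Hxy by trivial.
  rewrite <- conj_by_mul, Hgx in Hxy by trivial.
  destruct (conj_by g y) as [[[y0 y1] y2] y3]; qunfold; lra. }
set (y' := conj_by g y) in *.
assert (H2 : exists h, SU2 h /\ conj_by h qi = qi /\ conj_by h y' = z).
{ destruct (Classical_Prop.classic (z = qopp y')) as [e|ne].
  - exists qi; split; [apply qi_pure|]; split; [qring|].
    rewrite e; clear e; destruct y' as [[[y0 y1] y2] y3]; destruct Hy'; qunfold; subst.
    apply mkq_eq; ring.
  - destruct (pure_transport y' z Hy' Hz ne) as [c H]; cbv zeta in H; destruct H as [h1 h2].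
    eexists; split; [exact h1|split; [|exact h2]].
    clear h2; unfold conj_by; match goal with |- qmul (qmul ?g _) _ = _ => set (u := g) in * end.
    (* [u] is a multiple of 1 - z y'. Both factors are orthogonal to i, so z y' lies in the span of
       1 and i and commutes with i; this is why [pure_transport] exhibits its conjugator
       explicitly. *)
    replace (qmul u qi) with (qmul qi u); [apply qmul_conjK, h1|].
    unfold u; destruct y' as [[[y0 y1] y2] y3]; destruct z as [[[z0 z1] z2] z3].
    destruct Hy', Hz; clear h1 u; qunfold; subst; apply mkq_eq; ring. }
destruct H2 as [h [Hh [Hhi Hhz]]].
exists (qmul h g); split; [apply SU2_mul; trivial|].
rewrite <- !conj_by_comp, Hgx; split; trivial.
Qed.

Lemma qexp_surj (x : quat) : SU2 x -> exists t Q, pure_unit Q /\ x = qexp t Q.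
Proof.
destruct x as [[[x0 x1] x2] x3]; intros H.
change R in (type of x0), (type of x1), (type of x2), (type of x3).
cbv beta iota delta [SU2] in H.
set (v := x1 ^ 2 + x2 ^ 2 + x3 ^ 2).
assert (Hv : 0 <= v) by (unfold v; nra).
assert (H0 : -1 <= x0 <= 1) by (unfold v in Hv; nra).
(* With this angle, sin t is the nonnegative norm of the imaginary part, and [Q] is the normalized
   imaginary part; if that part vanishes any direction works and k is taken. *)
exists (acos x0).
assert (Hc : cos (acos x0) = x0) by (apply cos_acos, H0).
assert (Hs : sin (acos x0) = sqrt v) by
  (rewrite sin_acos by apply H0; f_equal; unfold v, Rsqr; nra).
destruct (Req_dec v 0) as [e|ne].
- exists qk; split; [apply qk_pure|].
  cbv [qexp qk mkq]; rewrite Hc, Hs, e, sqrt_0.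
  assert (x1 = 0 /\ x2 = 0 /\ x3 = 0) as [-> [-> ->]] by (unfold v in e; repeat split; nra).
  apply mkq_eq; ring.
- assert (0 < sqrt v) by (apply sqrt_lt_R0; lra).
  assert (Hw : sqrt v * sqrt v = v) by (apply sqrt_sqrt, Hv).
  exists (mkq 0 (x1 / sqrt v) (x2 / sqrt v) (x3 / sqrt v)); split.
  + split; [|reflexivity]; cbv beta iota delta [SU2 mkq].
    transitivity ((x1 ^ 2 + x2 ^ 2 + x3 ^ 2) / (sqrt v * sqrt v));
      [field; lra | rewrite Hw; fold v; field; lra].
  + cbv [qexp mkq]; rewrite Hc, Hs; apply mkq_eq; field; lra.
Qed.

(** * The circle R/2piZ *)

Lemma cong_trig_nat (b : R) (n : nat) :
  cos (b + 2 * PI * INR n) = cos b /\ sin (b + 2 * PI * INR n) = sin b.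
Proof.
replace (b + 2 * PI * INR n) with (b + 2 * INR n * PI) by ring.
split; [apply cos_period | apply sin_period].
Qed.

Lemma cong_trig (b b' : R) : cong2pi b b' -> cos b' = cos b /\ sin b' = sin b.
Proof.
intros [m ->]; destruct (Z.le_gt_cases 0 m).
- rewrite <- (Z2Nat.id m), <- INR_IZR_INZ by assumption; apply cong_trig_nat.
- destruct (cong_trig_nat (b + 2 * PI * IZR m) (Z.to_nat (- m))) as [<- <-].
  rewrite INR_IZR_INZ, Z2Nat.id, opp_IZR by lia.
  split; f_equal; ring.
Qed.

Lemma cong_sym (b b' : R) : cong2pi b b' -> cong2pi b' b.
Proof. intros [m ->]; exists (- m)%Z; rewrite opp_IZR; ring. Qed.

Lemma cong_small (x : R) : exists m : Z, - PI < x + 2 * PI * IZR m <= PI.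
Proof.
pose proof PI_RGT_0 as hp.
(* With r = (- PI - x) / (2 PI), the integer [up r] satisfies r < up r <= r + 1, which is the
   required range after scaling. *)
destruct (archimed ((- PI - x) / (2 * PI))) as [h1 h2].
exists (up ((- PI - x) / (2 * PI))); revert h1 h2.
set (m := IZR _); intros h1 h2.
assert (e : - PI - x = 2 * PI * ((- PI - x) / (2 * PI))) by (field; lra).
set (r := (- PI - x) / (2 * PI)) in *; split; nra.
Qed.

Lemma cos_abs (x : R) : cos (Rabs x) = cos x.
Proof. unfold Rabs; destruct (Rcase_abs x); [apply cos_neg | reflexivity]. Qed.

(** Cosine decreases on [0, PI], so the representative of [x] in (- PI, PI] must be within [d] of 0.
    This turns a half-plane condition on (cos, sin) back into an arc. *)
Lemma cos_gt_near (x d : R) : 0 < d < PI -> cos d < cos x ->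
  exists y, cong2pi x y /\ Rabs y < d.
Proof.
intros hd h; destruct (cong_small x) as [m hm].
assert (hc : cong2pi x (x + 2 * PI * IZR m)) by (exists m; reflexivity).
exists (x + 2 * PI * IZR m); split; trivial.
destruct (cong_trig _ _ hc) as [e _]; rewrite <- e, <- (cos_abs (x + 2 * PI * IZR m)) in h.
set (y := x + 2 * PI * IZR m) in *.
destruct (Rlt_or_le (Rabs y) d) as [?|hle]; trivial; exfalso.
assert (Rabs y <= PI) by (apply Rabs_le; lra).
assert (cos (Rabs y) <= cos d) by (apply cos_decr_1; lra); lra.
Qed.

(** The hypotheses give cos (b' - b) = 1, and 0 is the only angle in (- PI, PI] with cosine 1. *)
Lemma trig_cong (b b' : R) : cos b = cos b' -> sin b = sin b' -> cong2pi b b'.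
Proof.
intros hc hs; destruct (cong_small (b' - b)) as [m hm].
assert (e : cos (b' - b + 2 * PI * IZR m) = 1).
{ destruct (cong_trig (b' - b) (b' - b + 2 * PI * IZR m)) as [-> _]; [exists m; reflexivity|].
  rewrite cos_minus, hc, hs; pose proof (sin2_cos2 b'); unfold Rsqr in *; lra. }
set (y := b' - b + 2 * PI * IZR m) in *.
assert (y = 0).
{ destruct (Req_dec y 0) as [?|ne]; trivial; exfalso.
  assert (0 < Rabs y) by (apply Rabs_pos_lt, ne).
  assert (Rabs y <= PI) by (apply Rabs_le; lra).
  assert (cos (Rabs y) < cos 0) by (apply cos_decreasing_1; lra).
  rewrite cos_abs, cos_0 in *; lra. }
exists (- m)%Z; rewrite opp_IZR; unfold y in *; lra.
Qed.

(** * Unit quaternions of the form e^{tk} and e^{tk} i *)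

Definition ek (t : R) : quat := qexp t qk.
Definition ei (t : R) : quat := qmul (qexp t qk) qi.

Lemma ekE (t : R) : ek t = mkq (cos t) 0 0 (sin t).
Proof. unfold ek; qring. Qed.

Lemma eiE (t : R) : ei t = mkq 0 (cos t) (sin t) 0.
Proof. unfold ei; qring. Qed.

Lemma ek_ek (s t : R) : qmul (ek s) (ek t) = ek (s + t).
Proof. rewrite !ekE, cos_plus, sin_plus; qring. Qed.

Lemma ek_ei (s t : R) : qmul (ek s) (ei t) = ei (s + t).
Proof. rewrite ekE, !eiE, cos_plus, sin_plus; qring. Qed.

Lemma ei_ek (s t : R) : qmul (ei s) (ek t) = ei (s - t).
Proof. rewrite ekE, !eiE, cos_minus, sin_minus; qring. Qed.

(** Moving i past e^{tk} reverses the angle t, and i^2 = -1 contributes the PI. *)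
Lemma ei_ei (s t : R) : qmul (ei s) (ei t) = ek (s - t + PI).
Proof. rewrite ekE, !eiE, neg_cos, neg_sin, cos_minus, sin_minus; qring. Qed.

Lemma conj_ek (t : R) : qconj (ek t) = ek (- t).
Proof. rewrite !ekE, cos_neg, sin_neg; qring. Qed.

Lemma conj_ei (t : R) : qconj (ei t) = ei (t + PI).
Proof. rewrite !eiE, neg_cos, neg_sin; qring. Qed.

Lemma ek_cong (s t : R) : cong2pi s t -> ek s = ek t.
Proof. intros h; destruct (cong_trig _ _ h) as [h1 h2]; rewrite !ekE, h1, h2; trivial. Qed.

Lemma ei_cong (s t : R) : cong2pi s t -> ei s = ei t.
Proof. intros h; destruct (cong_trig _ _ h) as [h1 h2]; rewrite !eiE, h1, h2; trivial. Qed.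

Lemma SU2_ek (t : R) : SU2 (ek t).
Proof.
rewrite ekE; cbv beta iota delta [SU2 mkq]; pose proof (sin2_cos2 t); unfold Rsqr in *; lra.
Qed.

Lemma pure_ei (t : R) : pure_unit (ei t).
Proof.
rewrite eiE; split; [|reflexivity].
cbv beta iota delta [SU2 mkq]; pose proof (sin2_cos2 t); unfold Rsqr in *; lra.
Qed.

Lemma ei_0 : ei 0 = qi.
Proof. rewrite eiE, cos_0, sin_0; reflexivity. Qed.

Lemma ek_0 : ek 0 = qone.
Proof. rewrite ekE, cos_0, sin_0; reflexivity. Qed.

Lemma ek_PI : ek PI = qopp qone.
Proof. rewrite ekE, cos_PI, sin_PI; qring. Qed.

(** Here e^{-(PI/2)k} i = - k i = - j, and e^{tk} j = j e^{-tk}; this puts the image of [th] in the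
    form [ei]. *)
Lemma ei_opp_PI2 (t : R) : ei (t - PI / 2) = qmul (qopp qj) (qexp (- t) qk).
Proof.
fold (ek (- t)); rewrite eiE, ekE, cos_minus, sin_minus, cos_neg, sin_neg, cos_PI2, sin_PI2.
qring.
Qed.

(** Conjugation by i fixes i and reverses every angle. It is the source of the symmetry beta -> -
    beta in the classification and of (gamma, theta) -> (- gamma, - theta) on the pillowcase. *)
Lemma conj_qi_ek (t : R) : conj_by qi (ek t) = ek (- t).
Proof. rewrite !ekE, cos_neg, sin_neg; qring. Qed.

Lemma conj_qi_ei (t : R) : conj_by qi (ei t) = ei (- t).
Proof. rewrite !eiE, cos_neg, sin_neg; qring. Qed.

(** * Representations and their classes *)

Definition conj_rep {X : Type} (g : quat) (rho : X -> quat) (x : X) : quat :=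
  conj_by g (rho x).

Lemma eval_SU2 {X : Type} (rho : X -> quat) (u : word X) :
  (forall x, SU2 (rho x)) -> SU2 (eval rho u).
Proof.
intros H; induction u; cbn [eval].
- apply SU2_one.
- apply H.
- apply SU2_mul; assumption.
- apply SU2_conj; assumption.
Qed.

Lemma eval_conj {X : Type} (g : quat) (rho : X -> quat) (u : word X) :
  SU2 g -> eval (conj_rep g rho) u = conj_by g (eval rho u).
Proof.
intros H; induction u; simpl.
- symmetry; apply conj_by_one, H.
- reflexivity.
- rewrite IHu1, IHu2; apply conj_by_mul, H.
- rewrite IHu; apply conj_by_conj.
Qed.

Lemma hom_conj {X : Type} rels (g : quat) (rho : X -> quat) :
  SU2 g -> hom rels rho -> hom rels (conj_rep g rho).
Proof.
intros Hg [H1 H2]; split; [intros x; apply SU2_conj_by; auto|].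
intros u v Huv; rewrite !eval_conj, (H2 u v); trivial.
Qed.

Lemma cls_conj {X : Type} (g : quat) (rho : X -> quat) :
  SU2 g -> cls (conj_rep g rho) = cls rho.
Proof.
intros Hg; apply functional_extensionality; intros sigma.
apply propositional_extensionality; unfold cls, conjugate; split; intros [h [Hh H]].
- exists (qmul h g); split; [apply SU2_mul; trivial|].
  intros x; rewrite (H x); apply conj_by_comp.
- exists (qmul h (qconj g)); split; [apply SU2_mul; [|apply SU2_conj]; trivial|].
  intros x; rewrite (H x).
  change (conj_by h (rho x) = conj_by (qmul h (qconj g)) (conj_by g (rho x))).
  rewrite <- conj_by_comp, conj_byK; trivial.
Qed.

Lemma cls_eq {X : Type} (rho rho' : X -> quat) :
  cls rho = cls rho' <-> exists g, SU2 g /\ rho' = conj_rep g rho.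
Proof.
split.
- intros e; assert (H : cls rho rho').
  { rewrite e; exists qone; split; [apply SU2_one|].
    intros x; symmetry; apply conj_one_by. }
  destruct H as [g [Hg H]]; exists g; split; [exact Hg|].
  apply functional_extensionality, H.
- intros [g [Hg ->]]; symmetry; apply cls_conj, Hg.
Qed.

(** The real part is half the trace in SU(2), so real parts of words are class functions; every
    distinction between classes below is made with them. *)
Lemma re_eval_cls {X : Type} (rho rho' : X -> quat) (u : word X) :
  cls rho = cls rho' -> re (eval rho u) = re (eval rho' u).
Proof.
intros e; apply cls_eq in e; destruct e as [g [Hg ->]].
rewrite eval_conj, re_conj_by; trivial.
Qed.

(** A conjugator of the restricted representation also conjugates the whole one, so restricting all
    members of a class yields a full class. *)
Lemma restrict_cls (rho : tgen -> quat) :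
  restrict (cls rho) = cls (fun s => rho (sphere_incl s)).
Proof.
apply functional_extensionality; intros sigma.
apply propositional_extensionality; split.
- intros [rho' [[g [Hg H]] Hs]]; exists g; split; [exact Hg|].
  intros s; rewrite Hs; apply H.
- intros [g [Hg H]]; exists (conj_rep g rho); split; [|exact H].
  exists g; split; [exact Hg | reflexivity].
Qed.

(** * The circle of representations *)

(* Under [rho_eps f eps beta], [a p^-1 h lambda_P] is sent to [- k e^{beta k}]. *)
Definition word_tri : word tgen :=
  Mul (Mul (Mul (Gen ta) (Inv (Gen tp))) (Gen th)) lambda_P.

Lemma periodic_cong (f : R -> R) (b b' : R) :
  (forall x, f (x + 2 * PI) = f x) -> cong2pi b b' -> f b' = f b.
Proof.
intros hf.
assert (hn : forall (n : nat) x, f (x + 2 * PI * INR n) = f x).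
{ induction n as [|n IH]; intros x; [f_equal; simpl; ring|].
  rewrite <- (IH x), <- (hf (x + 2 * PI * INR n)), S_INR; f_equal; ring. }
intros [m ->]; destruct (Z.le_gt_cases 0 m).
- rewrite <- (Z2Nat.id m), <- INR_IZR_INZ by assumption; apply hn.
- rewrite <- (hn (Z.to_nat (- m)) (b + _)).
  rewrite INR_IZR_INZ, Z2Nat.id, opp_IZR by lia; f_equal; ring.
Qed.

(** If sin b = 0 then - b and b agree mod 2 PI, so periodicity and oddness give f b = f (- b) = - f
    b. *)
Lemma perturbation_zero (f : R -> R) (b : R) :
  perturbation_function f -> f b = 0 <-> sin b = 0.
Proof.
intros (_ & hodd & hper & _ & hz); split; intros h.
- destruct (hz b h) as [n ->]; apply sin_eq_0_1; exists n; reflexivity.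
- assert (f (- b) = f b); [|rewrite hodd in *; lra].
  apply periodic_cong; trivial; apply trig_cong; rewrite ?cos_neg, ?sin_neg, ?h; ring.
Qed.

Lemma rho_epsE (f : R -> R) (e b : R) (t : tgen) :
  rho_eps f e b t =
  match t with
  | ta => ei 0
  | tb => ei (PI / 2 + b + e * f b)
  | tc => ei (PI / 2 + b - e * f b)
  | td => ei (- (2 * e * f b))
  | th => ei (e * f b - PI / 2)
  | tw => ek PI
  | tp => ek (e * f b)
  end.
Proof.
destruct t; try reflexivity; simpl.
- symmetry; apply ei_0.
- symmetry; apply ei_opp_PI2.
- symmetry; apply ek_PI.
Qed.

Ltac eke := repeat first [rewrite ek_ek | rewrite ek_ei | rewrite ei_ek | rewrite ei_ei
                         | rewrite conj_ek | rewrite conj_ei].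
Ltac cong m := first [apply ek_cong | apply ei_cong]; exists m; field.

Lemma rho_eps_hom (f : R -> R) (e b : R) : hom tangle_rels (rho_eps f e b).
Proof.
split.
- intros x; rewrite rho_epsE; destruct x; first [apply pure_ei | apply SU2_ek].
- intros u v [E|[E|[E|[E|[]]]]]; injection E as <- <-; unfold Comm, lambda_P; cbn [eval];
    rewrite !rho_epsE; try rewrite <- ek_0; eke;
    (* The angles of the two sides of a relation differ by a number of full turns that depends on
       the relation. *)
    first [cong 0%Z | cong 1%Z | cong (-1)%Z | cong 2%Z | cong (-2)%Z].
Qed.

Lemma rho_eps_lambda (f : R -> R) (e b : R) : eval (rho_eps f e b) lambda_P = ek b.
Proof. unfold lambda_P; cbn [eval]; rewrite !rho_epsE; eke; cong (-1)%Z. Qed.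

Lemma re_lambda (f : R -> R) (e b : R) : re (eval (rho_eps f e b) lambda_P) = cos b.
Proof. rewrite rho_eps_lambda, ekE; reflexivity. Qed.

Lemma re_tri (f : R -> R) (e b : R) : re (eval (rho_eps f e b) word_tri) = sin b.
Proof.
unfold word_tri; cbn [eval]; rewrite rho_eps_lambda, !rho_epsE; eke.
rewrite ekE; unfold re; simpl.
replace (_ + b) with (b + PI / 2 + PI) by field.
rewrite neg_cos, cos_plus, cos_PI2, sin_PI2; ring.
Qed.

(** The value of [e] is arbitrary, so this serves the perturbed circles and the limit circle e = 0
    alike. *)
Lemma cls_rho_eps_eq (f : R -> R) (e b b' : R) : perturbation_function f ->
  cls (rho_eps f e b) = cls (rho_eps f e b') <-> cong2pi b b'.
Proof.
intros (_ & _ & hper & _); split; intros h.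
- apply trig_cong; [rewrite <- !(re_lambda f e) | rewrite <- !(re_tri f e)];
    apply re_eval_cls, h.
- f_equal; apply functional_extensionality; intros t.
  pose proof (periodic_cong f b b' hper h) as hfb; destruct h as [m ->].
  rewrite !rho_epsE, hfb.
  destruct t; trivial; apply ei_cong; exists m; ring.
Qed.

Lemma qexp_opp_qk (t : R) : qexp t (mkq 0 0 0 (-1)) = ek (- t).
Proof. rewrite ekE, cos_neg, sin_neg; qring. Qed.

(** The perturbation condition ranges over all ways of writing e^{bk} as e^{b'Q}. If sin b' <> 0,
    then Q = k or Q = - k with b' congruent to b or - b, and oddness of [f] makes both give the same
    image of [tp]. If sin b' = 0, then [Q] is arbitrary, but [f] vanishes at [b] and [b'] and the
    condition reads p = 1. *)
Lemma rho_eps_nat_rep (f : R -> R) (e b : R) :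
  perturbation_function f -> nat_rep f e (rho_eps f e b).
Proof.
intros hf; split; [apply rho_eps_hom|].
repeat (split; [rewrite rho_epsE; apply pure_ei|]).
split; [reflexivity|].
intros b' Q; destruct Q as [[[q0 q1] q2] q3].
change R in (type of q0), (type of q1), (type of q2), (type of q3).
intros [hQ h0]; cbv beta iota delta [SU2] in hQ, h0; subst q0.
rewrite rho_eps_lambda, rho_epsE, ekE; intros E.
pose proof (f_equal re E) as E0; pose proof (f_equal im1 E) as E1;
pose proof (f_equal im2 E) as E2; pose proof (f_equal im3 E) as E3; clear E.
cbv [re im1 im2 im3 qexp mkq fst snd] in E0, E1, E2, E3.
destruct (Req_dec (sin b') 0) as [hs|hs].
- assert (hs' : sin b = 0) by (rewrite E3, hs; ring).
  apply (perturbation_zero f) in hs; apply (perturbation_zero f) in hs'; trivial.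
  rewrite hs, hs', !Rmult_0_r, ek_0; cbv [qexp]; rewrite cos_0, sin_0.
  apply mkq_eq; ring.
- assert (q1 = 0 /\ q2 = 0) as [-> ->].
  { symmetry in E1, E2; apply Rmult_integral in E1; apply Rmult_integral in E2; tauto. }
  destruct hf as (_ & hodd & hper & _).
  assert (hq : (q3 - 1) * (q3 + 1) = 0) by lra.
  apply Rmult_integral in hq; destruct hq as [hq|hq].
  + replace q3 with 1 by lra; replace q3 with 1 in E3 by lra.
    rewrite (periodic_cong f b b'); trivial; apply trig_cong; lra.
  + replace q3 with (-1) by lra; replace q3 with (-1) in E3 by lra.
    replace (f b') with (- f b).
    * rewrite qexp_opp_qk; f_equal; ring.
    * rewrite <- hodd; symmetry; apply periodic_cong; trivial.
      apply trig_cong; rewrite ?cos_neg, ?sin_neg; lra.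
Qed.

(** * Classification of the perturbed representations *)

(** From lambda_P = b h one recovers b, and the first two relations then express c and d. *)
Lemma tangle_hom_ext (rho rho' : tgen -> quat) :
  hom tangle_rels rho -> hom tangle_rels rho' ->
  rho ta = rho' ta -> rho th = rho' th -> rho tp = rho' tp -> rho tw = rho' tw ->
  eval rho lambda_P = eval rho' lambda_P -> rho = rho'.
Proof.
intros [hS hR] [hS' hR'] ea eh ep ew el.
assert (eb : rho tb = rho' tb).
{ rewrite <- (qmul_conjK (rho tb) (rho th)), <- (qmul_conjK (rho' tb) (rho' th)) by trivial.
  rewrite <- eh; f_equal; simpl in el; rewrite <- eh in el; exact el. }
assert (ec : rho tc = rho' tc).
{ specialize (hR _ _ (or_introl eq_refl)); specialize (hR' _ _ (or_introl eq_refl)).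
  cbn [eval] in hR, hR'; rewrite hR, hR', ep, eb; reflexivity. }
assert (ed : rho td = rho' td).
{ specialize (hR _ _ (or_intror (or_introl eq_refl)));
  specialize (hR' _ _ (or_intror (or_introl eq_refl))).
  cbn [eval] in hR, hR'; rewrite hR, hR', ec, ea, eb; reflexivity. }
apply functional_extensionality; intros []; assumption.
Qed.

(* [w = -1] turns the fourth relation into [x h x^-1 h^-1 = -1] with [x = a p^-1]. *)
Lemma tangle_anticomm (rho : tgen -> quat) :
  hom tangle_rels rho -> rho tw = qopp qone ->
  let x := qmul (rho ta) (qconj (rho tp)) in
  qmul x (rho th) = qopp (qmul (rho th) x).
Proof.
intros [hS hR] hw x.
specialize (hR _ _ (or_intror (or_intror (or_intror (or_introl eq_refl))))).
unfold Comm in hR; cbn [eval] in hR; rewrite hw in hR.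
assert (hr : qmul (qmul (qmul (rho th) (rho ta)) (qopp qone))
               (qmul (qconj (rho ta)) (qconj (rho th))) = qopp qone).
{ rewrite <- qconj_mul, qmul_oppr, qmul_oppl, qmul_1r, qmul_conj_r
    by (apply SU2_mul; trivial); reflexivity. }
rewrite hr in hR; clear hr; fold x in hR.
assert (hx : SU2 x) by (apply SU2_mul; [|apply SU2_conj]; trivial).
(* Inserting x^-1 x and then h^-1 h exposes the commutator of x and h, which equals -1. *)
rewrite <- (qmul_conjK (qmul x (rho th)) (qconj x)), qconj_conj by (apply SU2_conj, hx).
rewrite <- (qmul_conjK (qmul (qmul x (rho th)) (qconj x)) (qconj (rho th))), qconj_conj, hR
  by (apply SU2_conj; trivial).
rewrite !qmul_oppl, qmul_1l; reflexivity.
Qed.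

(** For pure [h], the sum x h + h x is 2 re(x) h plus the real number 2 re(x h), so its vanishing
    kills both terms. *)
Lemma anticomm_re (x h : quat) : pure_unit h -> qmul x h = qopp (qmul h x) ->
  re x = 0 /\ re (qmul x h) = 0.
Proof.
intros [hh h0] E.
pose proof (f_equal re E) as E0; pose proof (f_equal im1 E) as E1;
pose proof (f_equal im2 E) as E2; pose proof (f_equal im3 E) as E3; clear E.
qunfold; subst; split; [|lra].
match type of hh with _ + ?a ^ 2 + ?b ^ 2 + ?c ^ 2 = 1 =>
  match goal with |- ?x = 0 =>
    transitivity (x * (0 ^ 2 + a ^ 2 + b ^ 2 + c ^ 2)); [rewrite hh; ring|];
    assert (x * a = 0) by lra; assert (x * b = 0) by lra; assert (x * c = 0) by lra;
    transitivity ((x * a) * a + (x * b) * b + (x * c) * c); [ring|];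
    replace (x * a) with 0; replace (x * b) with 0; replace (x * c) with 0; ring
  end end.
Qed.

Lemma qexp_sin0 (t : R) (Q : quat) : sin t = 0 -> qexp t Q = ek t.
Proof. intros h; rewrite ekE; qunfold; rewrite h; apply mkq_eq; ring. Qed.

(** Recognizing a class reduces to one conjugator matching a, h, p and lambda_P; w = -1 is central
    and matches automatically. *)
Lemma tangle_normal_form (f : R -> R) (e b : R) (g : quat) (rho : tgen -> quat) :
  SU2 g -> hom tangle_rels rho -> rho tw = qopp qone ->
  conj_by g (rho ta) = qi -> conj_by g (rho th) = ei (e * f b - PI / 2) ->
  conj_by g (rho tp) = ek (e * f b) -> conj_by g (eval rho lambda_P) = ek b ->
  cls rho = cls (rho_eps f e b).
Proof.
intros hg hr hw ha hh hp hl; rewrite <- (cls_conj g) by trivial; f_equal.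
apply tangle_hom_ext.
- apply hom_conj; trivial.
- apply rho_eps_hom.
- exact ha.
- rewrite rho_epsE; exact hh.
- exact hp.
- unfold conj_rep, conj_by; rewrite hw, qmul_oppr, qmul_oppl, qmul_1r, qmul_conj_r; trivial.
- rewrite eval_conj, rho_eps_lambda; trivial.
Qed.

Lemma sin_small_neq0 (s : R) : s <> 0 -> Rabs s < 1 -> sin s <> 0.
Proof.
intros h0 h1; apply Rabs_def2 in h1; pose proof PI_RGT_0; pose proof PI2_1.
destruct (Rdichotomy _ _ h0).
- apply Rlt_not_eq, sin_lt_0_var; lra.
- apply Rgt_not_eq, sin_gt_0; lra.
Qed.

(** This bound is the origin of the threshold 1 for the perturbation parameter: since 1 < PI / 2,
    the angle e f(b) has nonzero cosine, and nonzero sine unless it is 0. *)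
Lemma eps_f_small (f : R -> R) (e b : R) : perturbation_function f -> 0 < e < 1 ->
  Rabs (e * f b) < 1.
Proof.
intros (_ & _ & _ & hb & _) he; specialize (hb b).
rewrite Rabs_mult, (Rabs_right e) by lra; pose proof (Rabs_pos (f b)); nra.
Qed.

Lemma nat_rep_class (f : R -> R) (e : R) (rho : tgen -> quat) :
  perturbation_function f -> 0 < e < 1 -> nat_rep f e rho ->
  exists b, cls rho = cls (rho_eps f e b).
Proof.
intros hf he (hr & pa & pb & _ & _ & ph & hw & hp).
pose proof (tangle_anticomm rho hr hw) as hx; cbv zeta in hx.
destruct (qexp_surj (eval rho lambda_P)) as [b [Q [pQ hl]]]; [apply eval_SU2, hr|].
specialize (hp b Q pQ hl).
destruct (Req_dec (sin b) 0) as [hs|hs].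
(* Here lambda_P is 1 or -1, so [Q] carries no information; p = 1, and the pair (a, h) is moved to
   (i, - j). *)
- assert (hfb : e * f b = 0) by (apply (perturbation_zero f) in hs; trivial; rewrite hs; ring).
  assert (hp1 : rho tp = qone).
  { rewrite hp, hfb, qexp_sin0; [apply ek_0 | apply sin_0]. }
  rewrite hp1 in hx; replace (qconj qone) with qone in hx by qring; rewrite qmul_1r in hx.
  destruct (anticomm_re _ _ ph hx) as [_ h0].
  destruct (frame_transport _ _ (qopp qj) pa ph h0 qj_opp_pure) as (g & hg & ga & gh).
  { cbv; ring. }
  exists b; apply (tangle_normal_form f e b g); trivial; rewrite ?hfb.
  + rewrite gh, eiE, cos_minus, sin_minus, cos_PI2, sin_PI2, cos_0, sin_0; qring.
  + rewrite hp1, ek_0; apply conj_by_one, hg.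
  + rewrite hl, qexp_conj_by by trivial; apply qexp_sin0, hs.
- set (s := e * f b) in *.
  assert (hss : sin s <> 0).
  { apply sin_small_neq0; [|apply eps_f_small; trivial].
    unfold s; intros h; apply hs; apply (perturbation_zero f); trivial.
    apply Rmult_integral in h; destruct h; lra. }
  destruct (anticomm_re _ _ ph hx) as [hx0 hxh].
  (* As a is pure, re (a p^-1) = - sin s re (a Q), and sin s can be cancelled. *)
  assert (haQ : re (qmul (rho ta) Q) = 0).
  { rewrite hp in hx0; clear - hx0 pa pQ hss; destruct pa as [_ pa]; destruct pQ as [_ pQ].
    destruct (rho ta) as [[[a0 a1] a2] a3]; qunfold; subst.
    apply (Rmult_eq_reg_l (sin s)); [lra | exact hss]. }
  destruct (frame_transport _ _ qk pa pQ haQ qk_pure) as (g & hg & ga & gQ); [reflexivity|].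
  assert (gp : conj_by g (rho tp) = ek s) by (rewrite hp, qexp_conj_by, gQ; trivial).
  assert (gl : conj_by g (eval rho lambda_P) = ek b) by (rewrite hl, qexp_conj_by, gQ; trivial).
  assert (gb : pure_unit (conj_by g (rho tb))) by (apply pure_conj_by; trivial).
  assert (gh : pure_unit (conj_by g (rho th))) by (apply pure_conj_by; trivial).
  assert (gx : re (qmul (ei s) (conj_by g (rho th))) = 0).
  { rewrite <- (re_conj_by g), <- conj_by_mul, <- conj_by_mul, <- conj_by_conj, ga, gp in hxh
      by trivial.
    rewrite <- ei_0, conj_ek, ei_ek in hxh; rewrite <- hxh; do 3 f_equal; ring. }
  assert (gbE : conj_by g (rho tb) = qmul (ek b) (qconj (conj_by g (rho th)))).
  { rewrite <- gl; unfold lambda_P; cbn [eval]; rewrite <- conj_by_mul by trivial.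
    symmetry; apply qmul_conjK, gh. }
  destruct (conj_by g (rho th)) as [[[h0 h1] h2] h3] eqn:gth.
  rewrite gbE, ekE in gb; rewrite eiE in gx.
  change R in (type of h0), (type of h1), (type of h2), (type of h3).
  clear hx0 hxh haQ hx.
  destruct gh as [gh gh0]; destruct gb as [_ gb]; unfold SU2, re in *.
  cbv beta iota delta [re SU2 qmul qconj mkq fst snd] in gb, gh, gh0, gx; subst h0.
  (* Purity of b = lambda_P h^-1 reads sin b h3 = 0. *)
  assert (h3 = 0).
  { assert (h : sin b * h3 = 0) by lra; apply Rmult_integral in h; tauto. }
  subst h3.
  pose proof (sin2_cos2 s) as sc; unfold Rsqr in sc.
  (* Now h lies in the plane of i and j, orthogonal to cos s i + sin s j, hence h = kappa (sin s i -
     cos s j) with kappa = 1 or -1. *)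
  set (kappa := h1 * sin s - h2 * cos s).
  assert (e1 : h1 = kappa * sin s).
  { transitivity (h1 * (sin s * sin s + cos s * cos s) - cos s * (cos s * h1 + sin s * h2));
      [rewrite sc; replace (cos s * h1 + sin s * h2) with 0 by lra | unfold kappa]; ring. }
  assert (e2 : h2 = - kappa * cos s).
  { transitivity (h2 * (sin s * sin s + cos s * cos s) - sin s * (cos s * h1 + sin s * h2));
      [rewrite sc; replace (cos s * h1 + sin s * h2) with 0 by lra | unfold kappa]; ring. }
  assert (hk : (kappa - 1) * (kappa + 1) = 0).
  { transitivity (kappa ^ 2 * (sin s * sin s + cos s * cos s) - 1); [rewrite sc; ring|].
    rewrite <- gh, e1, e2; ring. }
  apply Rmult_integral in hk; destruct hk as [hk|hk].
  + exists b; apply (tangle_normal_form f e b g); trivial; fold s.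
    rewrite gth, eiE, cos_minus, sin_minus, cos_PI2, sin_PI2, e1, e2.
    replace kappa with 1 by lra; apply mkq_eq; ring.
  (* For kappa = -1, a further conjugation by i fixes a, sends e^{(s + PI/2)k} i to e^{(- s -
     PI/2)k} i and negates the angles of p and lambda_P. *)
  + exists (- b).
    assert (hs' : e * f (- b) = - s) by (destruct hf as (_ & -> & _); unfold s; ring).
    apply (tangle_normal_form f e (- b) (qmul qi g)); trivial.
    * apply SU2_mul; [apply qi_pure | trivial].
    * rewrite <- conj_by_comp, ga; qring.
    * rewrite <- conj_by_comp, gth, hs', eiE, cos_minus, sin_minus, cos_PI2, sin_PI2, cos_neg,
        sin_neg, e1, e2.
      replace kappa with (-1) by lra; qring.
    * rewrite <- conj_by_comp, gp, hs'; apply conj_qi_ek.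
    * rewrite <- conj_by_comp, gl; apply conj_qi_ek.
Qed.

(** * Topology of the space of classes *)

Section Continuity.
Context {U : UniformSpace}.

Lemma continuous_Rplus (f g : U -> R) (x : U) :
  continuous f x -> continuous g x -> continuous (fun y => f y + g y) x.
Proof. apply (continuous_plus (V := R_NormedModule)). Qed.

Lemma continuous_Ropp (f : U -> R) (x : U) :
  continuous f x -> continuous (fun y => - f y) x.
Proof. apply (continuous_opp (V := R_NormedModule)). Qed.

Lemma continuous_Rminus (f g : U -> R) (x : U) :
  continuous f x -> continuous g x -> continuous (fun y => f y - g y) x.
Proof. apply (continuous_minus (V := R_NormedModule)). Qed.

Lemma continuous_Rmult (f g : U -> R) (x : U) :
  continuous f x -> continuous g x -> continuous (fun y => f y * g y) x.
Proof. apply (continuous_mult (K := R_AbsRing)). Qed.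

Lemma continuous_pair {V W : UniformSpace} (f : U -> V) (g : U -> W) (x : U) :
  continuous f x -> continuous g x ->
  continuous (fun y => (f y, g y) : prod_UniformSpace V W) x.
Proof.
intros hf hg; apply filterlim_locally; intros eps.
apply filterlim_locally with (eps := eps) in hf; apply filterlim_locally with (eps := eps) in hg.
generalize (filter_and _ _ hf hg); apply filter_imp; intros y [h1 h2]; split; trivial.
Qed.

Lemma continuous_mkq (f0 f1 f2 f3 : U -> R) (x : U) :
  continuous f0 x -> continuous f1 x -> continuous f2 x -> continuous f3 x ->
  continuous (fun y => mkq (f0 y) (f1 y) (f2 y) (f3 y)) x.
Proof. intros; unfold mkq; repeat apply continuous_pair; trivial. Qed.

End Continuity.

Ltac cont := repeat match goal with
  | |- continuous (fun y => ?f + ?g) _ => apply continuous_Rplus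
  | |- continuous (fun y => ?f - ?g) _ => apply continuous_Rminus
  | |- continuous (fun y => - ?f) _ => apply continuous_Ropp
  | |- continuous (fun y => ?f * ?g) _ => apply continuous_Rmult
  | |- continuous (fun y => ?c) _ => apply continuous_const
  | H : _ |- _ => exact H
  end.

(** All four coordinates go through the induction together, since a product mixes them. *)
Lemma continuous_eval {X : Type} (u : word X) (rho : fct_UniformSpace X quat) :
  continuous (fun r : fct_UniformSpace X quat => re (eval r u)) rho /\
  continuous (fun r : fct_UniformSpace X quat => im1 (eval r u)) rho /\
  continuous (fun r : fct_UniformSpace X quat => im2 (eval r u)) rho /\
  continuous (fun r : fct_UniformSpace X quat => im3 (eval r u)) rho.
Proof.
induction u as [|x|u [u0 [u1 [u2 u3]]] v [v0 [v1 [v2 v3]]]|u [u0 [u1 [u2 u3]]]]; cbn [eval].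
- repeat split; apply continuous_const.
- repeat split; apply filterlim_locally; intros eps;
    exists eps; intros r hr; specialize (hr x);
    destruct (r x) as [[[? ?] ?] ?]; destruct (rho x) as [[[? ?] ?] ?];
    destruct hr as [[[? ?] ?] ?]; assumption.
- assert (E0 : forall x y, re x * re y - im1 x * im1 y - im2 x * im2 y - im3 x * im3 y
                 = re (qmul x y)) by qring.
  assert (E1 : forall x y, re x * im1 y + im1 x * re y + im2 x * im3 y - im3 x * im2 y
                 = im1 (qmul x y)) by qring.
  assert (E2 : forall x y, re x * im2 y - im1 x * im3 y + im2 x * re y + im3 x * im1 y
                 = im2 (qmul x y)) by qring.
  assert (E3 : forall x y, re x * im3 y + im1 x * im2 y - im2 x * im1 y + im3 x * re y
                 = im3 (qmul x y)) by qring.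
  repeat split;
  [ eapply continuous_ext; [intros r; apply E0|]
  | eapply continuous_ext; [intros r; apply E1|]
  | eapply continuous_ext; [intros r; apply E2|]
  | eapply continuous_ext; [intros r; apply E3|] ]; cont.
- assert (E0 : forall x, re x = re (qconj x)) by qring.
  assert (E1 : forall x, - im1 x = im1 (qconj x)) by qring.
  assert (E2 : forall x, - im2 x = im2 (qconj x)) by qring.
  assert (E3 : forall x, - im3 x = im3 (qconj x)) by qring.
  repeat split;
  [ eapply continuous_ext; [intros r; apply E0|]
  | eapply continuous_ext; [intros r; apply E1|]
  | eapply continuous_ext; [intros r; apply E2|]
  | eapply continuous_ext; [intros r; apply E3|] ]; cont.
Qed.

(** * Open sets of classes cut out by class functions *)

(** The preimage of a union of open half-planes under the pair of class functions of [u] and [v].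
    The coefficients range over a family [C], so that one such set can describe any open subset of
    the circle. *)
Definition halfspaces {X : Type} (u v : word X) (C : R -> R -> R -> Prop)
    (x : conj_class X) : Prop :=
  exists rho c s d, x = cls rho /\ C c s d /\ d < c * re (eval rho u) + s * re (eval rho v).

Lemma halfspaces_cls {X : Type} (u v : word X) (C : R -> R -> R -> Prop) (rho : X -> quat) :
  halfspaces u v C (cls rho) <->
  exists c s d, C c s d /\ d < c * re (eval rho u) + s * re (eval rho v).
Proof.
split.
- intros (r & c & s & d & e & hC & h); exists c, s, d; split; trivial.
  rewrite (re_eval_cls rho r u), (re_eval_cls rho r v); trivial.
- intros (c & s & d & hC & h); exists rho, c, s, d; auto.
Qed.

Lemma halfspaces_open {X : Type} (rels : list (word X * word X)) (u v : word X)
  (C : R -> R -> R -> Prop) : open_classes rels (halfspaces u v C).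
Proof.
exists (fun r => exists c s d, C c s d /\ d < c * re (eval r u) + s * re (eval r v)).
split; [|intros rho _; apply halfspaces_cls].
intros rho (c & s & d & hC & h).
assert (hc : continuous (fun r : fct_UniformSpace X quat =>
                 c * re (eval r u) + s * re (eval r v)) rho).
{ destruct (continuous_eval u rho) as [? _]; destruct (continuous_eval v rho) as [? _]; cont. }
generalize (hc _ (open_gt d _ h)); unfold filtermap; apply filter_imp.
intros r hr; exists c, s, d; auto.
Qed.

(** A ball of the function space constrains all generators at once; as there are seven, their
    neighbourhoods can be intersected. *)
Lemma continuous_fct (phi : R -> fct_UniformSpace tgen quat) (x : R) :
  (forall t : tgen, continuous (fun y => phi y t) x) -> continuous phi x.
Proof.
intros h; apply filterlim_locally; intros eps.
assert (h' : forall t, locally x (fun y => ball (phi x t) eps (phi y t))).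
{ intros t; exact (proj1 (filterlim_locally _ _) (h t) eps). }
generalize (filter_and _ _ (filter_and _ _ (h' ta) (filter_and _ _ (h' tb) (h' tc)))
  (filter_and _ _ (filter_and _ _ (h' td) (h' th)) (filter_and _ _ (h' tw) (h' tp)))).
apply filter_imp; intros y H t; destruct t; tauto.
Qed.

(** Both parameters may vary: fixing [e] gives continuity along a circle, fixing [b] gives the limit
    as [e] tends to 0. *)
Lemma continuous_rho_eps (f e b : R -> R) (x : R) :
  (forall y, continuous f y) -> continuous e x -> continuous b x ->
  continuous (fun y => rho_eps f (e y) (b y) : fct_UniformSpace tgen quat) x.
Proof.
intros hf he hb; apply continuous_fct; intros t.
assert (hfb : continuous (fun y => f (b y)) x) by (apply (continuous_comp b f); trivial).
assert (hk : forall g : R -> R, continuous g x -> continuous (fun y => ek (g y)) x).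
{ intros g hg; eapply continuous_ext; [intros y; symmetry; apply ekE|].
  apply continuous_mkq; try apply continuous_const.
  - apply continuous_cos_comp, hg.
  - apply continuous_sin_comp, hg. }
assert (hi : forall g : R -> R, continuous g x -> continuous (fun y => ei (g y)) x).
{ intros g hg; eapply continuous_ext; [intros y; symmetry; apply eiE|].
  apply continuous_mkq; try apply continuous_const.
  - apply continuous_cos_comp, hg.
  - apply continuous_sin_comp, hg. }
eapply continuous_ext; [intros y; symmetry; apply rho_epsE|].
destruct t; [apply hi | apply hi | apply hi | apply hi | apply hi | apply hk | apply hk]; cont.
Qed.

Lemma perturbation_continuous (f : R -> R) (x : R) : perturbation_function f -> continuous f x.
Proof. intros [h _]; exact (ex_derive_continuous (V := R_NormedModule) f x (h 1%nat x)). Qed.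

(* [D] is the union of its arcs |y - b| < r, i.e. of { cos r < cos b cos y + sin b sin y },
   which in terms of the two class functions are open half-planes. *)
Lemma circle_param_rho_eps (f : R -> R) (e : R) (S : conj_class tgen -> Prop) :
  perturbation_function f -> (forall x, S x <-> exists b, x = cls (rho_eps f e b)) ->
  circle_param tangle_rels S (fun b => cls (rho_eps f e b)).
Proof.
intros hf hS; split; [exact hS|]; split; [intros; apply cls_rho_eps_eq, hf|].
intros D hD; split.
- intros hO.
  exists (halfspaces lambda_P word_tri (fun c s d => exists b r, 0 < r < PI /\
    (forall y, Rabs (y - b) < r -> D y) /\ c = cos b /\ s = sin b /\ d = cos r)).
  split; [apply halfspaces_open|]; intros b.
  rewrite halfspaces_cls, re_lambda, re_tri; split.
  + intros hb; destruct (hO b hb) as [r hr].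
    (* Shrinking the radius keeps it in (0, PI), where cos r' < cos 0 = 1, so that [b] satisfies its
       own half-plane inequality. *)
    set (r' := Rmin r 1); assert (h0 : 0 < r' <= 1).
    { unfold r'; split; [apply Rmin_glb_lt; [apply cond_pos | lra] | apply Rmin_r]. }
    pose proof PI2_1.
    exists (cos b), (sin b), (cos r'); split.
    * exists b, r'; split; [lra|]; split; [|auto].
      intros y hy; apply hr; apply Rlt_le_trans with (1 := hy), Rmin_l.
    * replace (cos b * cos b + sin b * sin b) with 1
        by (pose proof (sin2_cos2 b); unfold Rsqr in *; lra).
      rewrite <- cos_0; apply cos_decreasing_1; lra.
  + intros (c & s & d & (b0 & r & hr & hD0 & -> & -> & ->) & h).
    replace (cos b0 * cos b + sin b0 * sin b) with (cos (b - b0)) in h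
      by (rewrite cos_minus; ring).
    destruct (cos_gt_near _ _ hr h) as [y [[m hm] hy]].
    apply (hD b (b0 + y)); [exists m; rewrite hm; ring|].
    apply hD0; replace (b0 + y - b0) with y by ring; exact hy.
- intros (V & (W & hW & hVW) & hDV) b hb.
  (* For the converse, [D] is the preimage of the open set [W] under the continuous map y -> rho_eps
     f e y. *)
  assert (hc : continuous (fun y => rho_eps f e y : fct_UniformSpace tgen quat) b).
  { apply (continuous_rho_eps f (fun _ => e) (fun y => y)).
    - intros; apply perturbation_continuous, hf.
    - apply continuous_const.
    - apply continuous_id. }
  assert (h : forall y, D y <-> W (rho_eps f e y)).
  { intros y; rewrite hDV; apply hVW, rho_eps_hom. }
  apply h in hb; generalize (hc _ (hW _ hb)); unfold filtermap; apply filter_imp; intros y; apply h.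
Qed.

(** * The limit circle *)

Lemma rho_eps_lim (f : R -> R) (b : R) : perturbation_function f ->
  class_lim0 tangle_rels (fun e => cls (rho_eps f e b)) (cls (rho_eps f 0 b)).
Proof.
intros hf; split; [exists (rho_eps f 0 b); split; [apply rho_eps_hom | trivial]|].
intros U (V & hV & hUV) hU; apply hUV in hU; [|apply rho_eps_hom].
assert (hc : continuous (fun e => rho_eps f e b : fct_UniformSpace tgen quat) 0).
{ apply (continuous_rho_eps f (fun y => y) (fun _ => b)).
  - intros; apply perturbation_continuous, hf.
  - apply continuous_id.
  - apply continuous_const. }
apply filter_le_within.
generalize (hc _ (hV _ hU)); unfold filtermap; apply filter_imp; intros e; apply hUV, rho_eps_hom.
Qed.

(** If the real parts differed, the open half-lines on the two sides of their midpoint would contain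
    one limit each, yet for some e > 0 the class [x_ e] would satisfy both conditions. *)
Lemma class_lim0_re (X : Type) rels (x_ : R -> conj_class X) (rho rho' : X -> quat) (u : word X) :
  class_lim0 rels x_ (cls rho) -> class_lim0 rels x_ (cls rho') ->
  re (eval rho u) = re (eval rho' u).
Proof.
assert (main : forall r r' : X -> quat,
  class_lim0 rels x_ (cls r) -> class_lim0 rels x_ (cls r') ->
  re (eval r' u) <= re (eval r u)).
{ intros r r' [_ h] [_ h']; apply Rnot_lt_le; intros lt.
  set (d := (re (eval r u) + re (eval r' u)) / 2).
  (* The sign [sg] selects the side of the midpoint [d]; the second word gets coefficient 0. *)
  set (C := fun sg : R => halfspaces u u (fun c s e => c = sg /\ s = 0 /\ e = sg * d)).
  assert (hC : forall sg q, C sg (cls q) <-> sg * d < sg * re (eval q u)).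
  { intros sg q; unfold C; rewrite halfspaces_cls; split.
    - intros (c & s & e & (-> & -> & ->) & k); lra.
    - intros k; exists sg, 0, (sg * d); split; [auto|lra]. }
  assert (k : C (-1) (cls r)) by (apply hC; unfold d; lra).
  assert (k' : C 1 (cls r')) by (apply hC; unfold d; lra).
  generalize (filter_and _ _ (h _ (halfspaces_open _ _ _ _) k)
                             (h' _ (halfspaces_open _ _ _ _) k')); intros H.
  apply filter_ex in H; destruct H as [e [H H']].
  destruct H as (q & c & s & z & E & (-> & -> & ->) & H).
  rewrite E in H'; apply hC in H'; lra. }
intros h h'; apply Rle_antisym; apply main; trivial.
Qed.

(* [1, a, h, a h] is a real basis of the quaternions when [a], [h] are orthonormal, so the real
   parts of [t], [a t], [h t], [a h t] determine [t]. *)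
Lemma class_lim0_rho_eps (f : R -> R) (b : R) (x : conj_class tgen) :
  perturbation_function f ->
  class_lim0 tangle_rels (fun e => cls (rho_eps f e b)) x -> x = cls (rho_eps f 0 b).
Proof.
intros hf hx; pose proof hx as [[rho [hr ->]] _].
assert (hR : forall u, re (eval rho u) = re (eval (rho_eps f 0 b) u)).
{ intros u; apply (class_lim0_re _ _ _ _ _ u hx), rho_eps_lim, hf. }
clear hx.
assert (Eh : rho_eps f 0 b th = qopp qj).
{ rewrite rho_epsE, eiE, Rmult_0_l, cos_minus, sin_minus, cos_PI2, sin_PI2, cos_0, sin_0; qring. }
assert (pa : pure_unit (rho ta)).
{ apply pure_unitP; split; [apply hr|].
  change (re (eval rho (Gen ta)) = 0); rewrite hR; reflexivity. }
assert (ph : pure_unit (rho th)).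
{ apply pure_unitP; split; [apply hr|].
  change (re (eval rho (Gen th)) = 0); rewrite hR; cbn [eval]; rewrite Eh.
  apply Ropp_0. }
assert (pah : re (qmul (rho ta) (rho th)) = 0).
{ change (re (eval rho (Mul (Gen ta) (Gen th))) = 0); rewrite hR; cbn [eval]; rewrite Eh.
  cbv; ring. }
(* The traces of a, h and a h show that a and h are orthonormal, so they can be moved to their
   values i and - j in [rho_eps f 0 b]; the remaining traces then fix every coordinate. *)
destruct (frame_transport _ _ _ pa ph pah qj_opp_pure) as (g & hg & ga & gh).
{ cbv; ring. }
rewrite <- (cls_conj g) by trivial; f_equal.
assert (hR' : forall u, re (eval (conj_rep g rho) u) = re (eval (rho_eps f 0 b) u)).
{ intros u; rewrite eval_conj, re_conj_by; trivial. }
apply functional_extensionality; intros t.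
pose proof (hR' (Gen t)) as R0; pose proof (hR' (Mul (Gen ta) (Gen t))) as R1.
pose proof (hR' (Mul (Gen th) (Gen t))) as R2.
pose proof (hR' (Mul (Mul (Gen ta) (Gen th)) (Gen t))) as R3.
cbn [eval] in R0, R1, R2, R3.
change (conj_rep g rho ta) with (conj_by g (rho ta)) in *.
change (conj_rep g rho th) with (conj_by g (rho th)) in *.
change (rho_eps f 0 b ta) with qi in *.
rewrite ga, ?gh, ?Eh in *; clear - R0 R1 R2 R3.
destruct (conj_rep g rho t) as [[[? ?] ?] ?]; destruct (rho_eps f 0 b t) as [[[? ?] ?] ?].
cbv [re qmul qi qj qopp mkq fst snd] in R0, R1, R2, R3.
apply mkq_eq; lra.
Qed.

Lemma R_limE (f : R -> R) (x : conj_class tgen) : perturbation_function f ->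
  R_lim f x <-> exists b, x = cls (rho_eps f 0 b).
Proof.
intros hf; split; intros [b hb]; exists b.
- apply class_lim0_rho_eps; trivial.
- rewrite hb; apply rho_eps_lim, hf.
Qed.

(** * The limit circle in cylindrical coordinates *)

Lemma cyl_rep_th (gamma tau : R) : cyl_rep gamma tau th = mkq 0 0 (cos tau) (sin tau).
Proof. cbn [cyl_rep]; qring. Qed.

(** At e = 0 the image of [tb] has angle PI / 2 + beta, which gives beta = gamma - PI / 2. *)
Lemma cls_cyl_opp_qj (f : R -> R) (gamma tau : R) :
  cyl_rep gamma tau th = qopp qj ->
  cls (cyl_rep gamma tau) = cls (rho_eps f 0 (gamma - PI / 2)).
Proof.
intros h; f_equal; apply functional_extensionality; intros t.
rewrite rho_epsE; destruct t.
- symmetry; apply ei_0.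
- change (ei gamma = ei (PI / 2 + (gamma - PI / 2) + 0 * f (gamma - PI / 2))); f_equal; ring.
- change (ei gamma = ei (PI / 2 + (gamma - PI / 2) - 0 * f (gamma - PI / 2))); f_equal; ring.
- change (qi = ei (- (2 * 0 * f (gamma - PI / 2)))); rewrite <- ei_0; f_equal; ring.
- rewrite h, Rmult_0_l, eiE, cos_minus, sin_minus, cos_PI2, sin_PI2, cos_0, sin_0; qring.
- symmetry; apply ek_PI.
- rewrite Rmult_0_l; symmetry; apply ek_0.
Qed.

(** Conjugation by i exchanges j and - j and reverses gamma, reducing to the previous case. *)
Lemma cls_cyl_qj (f : R -> R) (gamma tau : R) :
  cyl_rep gamma tau th = qj ->
  cls (cyl_rep gamma tau) = cls (rho_eps f 0 (- gamma - PI / 2)).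
Proof.
intros h; rewrite <- (cls_cyl_opp_qj f (- gamma) PI).
- symmetry; apply cls_eq; exists qi; split; [apply qi_pure|].
  apply functional_extensionality; intros t; unfold conj_rep; destruct t.
  + cbn [cyl_rep]; qring.
  + change (ei gamma = conj_by qi (ei (- gamma))); rewrite conj_qi_ei; f_equal; ring.
  + change (ei gamma = conj_by qi (ei (- gamma))); rewrite conj_qi_ei; f_equal; ring.
  + cbn [cyl_rep]; qring.
  + rewrite h, cyl_rep_th, cos_PI, sin_PI; qring.
  + cbn [cyl_rep]; qring.
  + cbn [cyl_rep]; qring.
- rewrite cyl_rep_th, cos_PI, sin_PI; qring.
Qed.

(** Reduce b + PI / 2 to (- PI, PI]: a nonnegative value is gamma on the half tau = PI, a negative
    one is - gamma on the half tau = 0. *)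
Lemma cls_rho_0_cyl (f : R -> R) (b : R) : perturbation_function f ->
  exists gamma tau, 0 <= gamma <= PI /\ (tau = 0 \/ tau = PI) /\
    cls (rho_eps f 0 b) = cls (cyl_rep gamma tau).
Proof.
intros hf; destruct (cong_small (b + PI / 2)) as [m hm].
destruct (Rle_lt_dec 0 (b + PI / 2 + 2 * PI * IZR m)) as [h|h].
- exists (b + PI / 2 + 2 * PI * IZR m), PI; split; [lra|]; split; [auto|].
  rewrite (cls_cyl_opp_qj f) by (rewrite cyl_rep_th, cos_PI, sin_PI; qring).
  apply cls_rho_eps_eq; trivial; exists m; ring.
- exists (- (b + PI / 2 + 2 * PI * IZR m)), 0; split; [lra|]; split; [auto|].
  rewrite (cls_cyl_qj f) by (rewrite cyl_rep_th, cos_0, sin_0; qring).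
  apply cls_rho_eps_eq; trivial; exists m; ring.
Qed.

Lemma R_lim_cyl_h (f : R -> R) (x : conj_class tgen) : perturbation_function f ->
  R_lim f x <->
  exists gamma tau, 0 <= gamma <= PI /\ 0 <= tau <= 2 * PI /\
    (cyl_rep gamma tau th = qj \/ cyl_rep gamma tau th = qopp qj) /\
    x = cls (cyl_rep gamma tau).
Proof.
intros hf; rewrite R_limE by trivial; split.
- intros [b ->]; destruct (cls_rho_0_cyl f b hf) as (gamma & tau & hg & ht & E).
  pose proof PI_RGT_0.
  exists gamma, tau; split; [exact hg|]; split; [destruct ht; subst; lra|].
  split; [|exact E]; rewrite !cyl_rep_th.
  destruct ht as [-> | ->]; [left; rewrite cos_0, sin_0 | right; rewrite cos_PI, sin_PI]; qring.
- intros (gamma & tau & _ & _ & [h|h] & ->).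
  + exists (- gamma - PI / 2); apply cls_cyl_qj, h.
  + exists (gamma - PI / 2); apply cls_cyl_opp_qj, h.
Qed.

Lemma R_lim_cyl (f : R -> R) (x : conj_class tgen) : perturbation_function f ->
  R_lim f x <->
  exists gamma tau, 0 <= gamma <= PI /\ (tau = 0 \/ tau = PI) /\ x = cls (cyl_rep gamma tau).
Proof.
intros hf; split.
- intros h; apply R_limE in h; trivial; destruct h as [b ->]; apply cls_rho_0_cyl, hf.
- intros (gamma & tau & hg & ht & ->); apply R_lim_cyl_h; trivial.
  pose proof PI_RGT_0.
  exists gamma, tau; split; [exact hg|]; split; [destruct ht; subst; lra|].
  split; [|reflexivity]; rewrite !cyl_rep_th.
  destruct ht as [-> | ->]; [left; rewrite cos_0, sin_0 | right; rewrite cos_PI, sin_PI]; qring.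
Qed.

(** * The pillowcase *)

Lemma pillow_repE (gamma theta : R) (s : sgen) :
  pillow_rep gamma theta s =
  match s with sa => ei 0 | sb => ei gamma | sc => ei theta | sd => ei (theta - gamma) end.
Proof. destruct s; try reflexivity; symmetry; apply ei_0. Qed.

Lemma pillow_sphere (gamma theta : R) : R_sphere (pillow gamma theta).
Proof.
exists (pillow_rep gamma theta); split; [split|split; trivial].
- intros s; rewrite pillow_repE; destruct s; apply pure_ei.
- intros u v [E|[]]; injection E as <- <-; cbn [eval]; rewrite !pillow_repE; eke; cong 0%Z.
- intros s; rewrite pillow_repE; destruct s; apply pure_ei.
Qed.

Lemma pillow_cos (gamma theta gamma' theta' : R) :
  pillow gamma theta = pillow gamma' theta' -> cos gamma = cos gamma' /\ cos theta = cos theta'.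
Proof.
intros E; pose proof (re_eval_cls _ _ (Mul (Gen sa) (Gen sb)) E) as h1.
pose proof (re_eval_cls _ _ (Mul (Gen sa) (Gen sc)) E) as h2.
cbn [eval] in h1, h2; rewrite !pillow_repE, !ei_ei, !ekE in h1, h2.
cbv [re mkq fst snd] in h1, h2.
rewrite !neg_cos, !cos_minus, cos_0, sin_0 in h1, h2; lra.
Qed.

Lemma pillow_cong (gamma theta gamma' theta' : R) :
  cong2pi gamma gamma' -> cong2pi theta theta' -> pillow gamma theta = pillow gamma' theta'.
Proof.
intros [m ->] [n ->]; unfold pillow; f_equal; apply functional_extensionality; intros s.
rewrite !pillow_repE; destruct s; trivial; apply ei_cong.
- exists m; ring.
- exists n; ring.
- exists (n - m)%Z; rewrite minus_IZR; ring.
Qed.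

Lemma pillow_opp (gamma theta : R) : pillow (- gamma) (- theta) = pillow gamma theta.
Proof.
symmetry; apply cls_eq; exists qi; split; [apply qi_pure|].
apply functional_extensionality; intros s; unfold conj_rep; rewrite !pillow_repE.
destruct s; rewrite conj_qi_ei; f_equal; ring.
Qed.

Lemma sin_zero_of_cos (x : R) (m : Z) : cos x = cos (IZR m * PI) -> sin x = 0.
Proof.
intros h; pose proof (sin2_cos2 x) as h1; pose proof (sin2_cos2 (IZR m * PI)) as h2.
rewrite (sin_eq_0_1 (IZR m * PI)) in h2 by (exists m; reflexivity).
unfold Rsqr in *; rewrite h in h1; apply Rsqr_0_uniq; unfold Rsqr; lra.
Qed.

Lemma corner_sin (gamma theta : R) : corner (pillow gamma theta) -> sin gamma = 0 /\ sin theta = 0.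
Proof.
intros (m & n & E); apply pillow_cos in E; destruct E as [h1 h2].
split; eapply sin_zero_of_cos; eassumption.
Qed.

Lemma corner_diag (t : R) : corner (pillow t t) <-> sin t = 0.
Proof.
split; [intros h; apply corner_sin in h; tauto|].
intros h; apply sin_eq_0_0 in h; destruct h as [m ->]; exists m, m; reflexivity.
Qed.

(** * The restriction map on the circles *)

Lemma restrict_rho_eps (f : R -> R) (e b : R) :
  restrict (cls (rho_eps f e b)) =
  pillow (b + e * f b + PI / 2) (b - e * f b + PI / 2).
Proof.
rewrite restrict_cls; unfold pillow; f_equal; apply functional_extensionality; intros s.
rewrite pillow_repE, rho_epsE; destruct s; simpl; f_equal; ring.
Qed.

Lemma restrict_rho_0 (f : R -> R) (b : R) :
  restrict (cls (rho_eps f 0 b)) = pillow (b + PI / 2) (b + PI / 2).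
Proof. rewrite restrict_rho_eps; f_equal; ring. Qed.

Lemma ex_derive_n_affine (f : R -> R) (c d : R) (n : nat) (x : R) :
  (forall k y, ex_derive_n f k y) -> ex_derive_n (fun t => t + c * f t + d) n x.
Proof.
intros hf; apply ex_derive_n_plus; apply filter_forall; intros y k _;
  [|apply ex_derive_n_const].
apply ex_derive_n_plus; apply filter_forall; intros z j _.
- apply ex_derive_n_ext with (fun t => t ^ 1); [intros; ring | apply ex_derive_n_pow].
- apply ex_derive_n_scal_l, hf.
Qed.

Lemma Derive_affine (f : R -> R) (c d x : R) :
  ex_derive f x -> Derive (fun t => t + c * f t + d) x = 1 + c * Derive f x.
Proof.
intros h; apply is_derive_unique; auto_derive; [exact h|].
change (Derive (fun t => f t) x) with (Derive f x); ring.
Qed.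

(** The coordinates of the lift have derivatives 1 + e f'(b) and 1 - e f'(b), whose sum is 2, so
    they cannot both vanish. *)
Lemma restrict_immersion (f : R -> R) (e b : R) : perturbation_function f ->
  ~ corner (restrict (cls (rho_eps f e b))) ->
  pillow_immersion_at (fun t => restrict (cls (rho_eps f e t))) b.
Proof.
intros hf hc; split; [exact hc|]; destruct hf as [hs _].
exists (fun t => t + e * f t + PI / 2), (fun t => t + - e * f t + PI / 2); split.
- apply filter_forall; intros t; split.
  + rewrite restrict_rho_eps; f_equal; ring.
  + intros n; split; apply ex_derive_n_affine, hs.
- rewrite !Derive_affine by apply (hs 1%nat b); lra.
Qed.

(* The two coordinates differ by [2 eps f beta], which is less than [2 < PI] in absolute value:
   they can lie in [PI Z] simultaneously only if [f beta = 0], i.e. [beta] in [PI Z], but then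
   both are odd multiples of [PI / 2]. *)
Lemma restrict_not_corner (f : R -> R) (e b : R) : perturbation_function f -> 0 < e < 1 ->
  ~ corner (restrict (cls (rho_eps f e b))).
Proof.
intros hf he; rewrite restrict_rho_eps; intros h; apply corner_sin in h; destruct h as [h1 h2].
rewrite sin_plus, cos_PI2, sin_PI2 in h1, h2.
pose proof (eps_f_small f e b hf he) as hb.
rewrite cos_plus in h1; rewrite cos_minus in h2.
set (s := e * f b) in *.
(* The corner conditions are cos (b + s) = 0 and cos (b - s) = 0; this is their half-sum, and the
   next line comes from their difference. *)
assert (k1 : cos b * cos s = 0) by lra.
assert (k2 : sin b * sin s = 0) by lra.
assert (hcs : cos s <> 0).
{ apply Rgt_not_eq, cos_gt_0; apply Rabs_def2 in hb; pose proof PI2_1; lra. }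
apply Rmult_integral in k1; destruct k1 as [k1|k1]; [|contradiction].
assert (hsb : sin b <> 0).
{ intros k; pose proof (sin2_cos2 b); unfold Rsqr in *; rewrite k, k1 in *; lra. }
apply Rmult_integral in k2; destruct k2 as [k2|k2]; [contradiction|].
destruct (Req_dec s 0) as [k|k]; [|exact (sin_small_neq0 s k hb k2)].
apply hsb, (perturbation_zero f); trivial.
apply Rmult_integral in k; destruct k; lra.
Qed.

Lemma cos_zero_cong (b : R) :
  cos b = 0 <-> cong2pi (PI / 2) b \/ cong2pi (3 * PI / 2) b.
Proof.
assert (e : 3 * PI / 2 = PI / 2 + PI) by field.
split.
- intros h; pose proof (sin2_cos2 b) as hs; unfold Rsqr in hs; rewrite h in hs.
  assert (k : (sin b - 1) * (sin b + 1) = 0) by lra.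
  apply Rmult_integral in k; destruct k as [k|k]; [left|right]; apply trig_cong;
    rewrite ?e, ?neg_cos, ?neg_sin, ?cos_PI2, ?sin_PI2; lra.
- intros [h|h]; apply cong_trig in h; destruct h as [-> _];
    rewrite ?e, ?neg_cos, ?cos_PI2; ring.
Qed.

Lemma corner_restrict_0 (f : R -> R) (b : R) :
  corner (restrict (cls (rho_eps f 0 b))) <->
  cong2pi (PI / 2) b \/ cong2pi (3 * PI / 2) b.
Proof.
rewrite restrict_rho_0, corner_diag, <- cos_zero_cong, sin_plus, cos_PI2, sin_PI2; split; lra.
Qed.

(** The involution t -> - t folds the diagonal; in terms of t = beta + PI / 2 it is beta -> - beta -
    PI. Conversely, equal cosines of t give equal sines of beta, which leaves only these two
    possibilities. *)
Lemma restrict_rho_0_eq (f : R -> R) (b b' : R) :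
  restrict (cls (rho_eps f 0 b')) = restrict (cls (rho_eps f 0 b)) <->
  cong2pi b b' \/ cong2pi (- b - PI) b'.
Proof.
assert (e1 : cos (- b - PI) = - cos b) by
  (rewrite cos_minus, cos_neg, cos_PI, sin_PI; ring).
assert (e2 : sin (- b - PI) = sin b) by
  (rewrite sin_minus, sin_neg, cos_PI, sin_PI; ring).
rewrite !restrict_rho_0; split.
- intros E; apply pillow_cos in E; destruct E as [E _].
  rewrite !cos_plus, cos_PI2, sin_PI2 in E.
  assert (hs : sin b = sin b') by lra.
  destruct (Req_dec (cos b) (cos b')) as [h|h]; [left; apply trig_cong; trivial|].
  right; apply trig_cong; rewrite ?e1, ?e2; trivial.
  pose proof (sin2_cos2 b) as k; pose proof (sin2_cos2 b') as k'; unfold Rsqr in *.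
  rewrite hs in k; assert (z : (cos b - cos b') * (cos b + cos b') = 0) by lra.
  apply Rmult_integral in z; destruct z; lra.
- intros [[m ->]|[m ->]].
  + symmetry; apply pillow_cong; exists m; ring.
  + rewrite <- (pillow_opp (b + PI / 2)).
    symmetry; apply pillow_cong; exists m; field.
Qed.

(** The two preimages are the parameters b and - b - PI, which coincide only where cos b = 0, that
    is, over a corner. *)
Lemma restrict_two_to_one (f : R -> R) (y : conj_class sgen) : perturbation_function f ->
  (exists x, R_lim f x /\ restrict x = y) -> ~ corner y ->
  exists x1 x2, x1 <> x2 /\ forall x, (R_lim f x /\ restrict x = y) <-> (x = x1 \/ x = x2).
Proof.
intros hf [x0 [hx hy]] hc; apply R_limE in hx; trivial; destruct hx as [b ->]; subst y.
exists (cls (rho_eps f 0 b)), (cls (rho_eps f 0 (- b - PI))); split.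
- intros E; apply cls_rho_eps_eq in E; trivial; apply cong_trig in E; destruct E as [E _].
  rewrite cos_minus, cos_neg, cos_PI, sin_PI in E.
  apply hc, corner_restrict_0, cos_zero_cong; lra.
- intros x; split.
  + intros [hx E]; apply R_limE in hx; trivial; destruct hx as [b' ->].
    apply restrict_rho_0_eq in E.
    destruct E as [E|E]; [left|right]; apply cls_rho_eps_eq; trivial; apply cong_sym, E.
  + assert (refl : forall z, cong2pi z z) by (intros z; exists 0%Z; ring).
    intros [-> | ->]; (split; [apply R_limE; eauto | apply restrict_rho_0_eq; auto]).
Qed.

Lemma R_natE (f : R -> R) (e : R) (x : conj_class tgen) :
  perturbation_function f -> 0 < e < 1 ->
  R_nat f e x <-> exists b, x = cls (rho_eps f e b).
Proof.
intros hf he; split.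
- intros [rho [hr ->]]; apply nat_rep_class; trivial.
- intros [b ->]; exists (rho_eps f e b); split; [apply rho_eps_nat_rep, hf | reflexivity].
Qed.

Theorem corollary7p2 (f : R -> R) (hf : perturbation_function f) :
  (exists eps0 : R, 0 < eps0 /\ forall eps : R, 0 < eps < eps0 ->
     circle_param tangle_rels (R_nat f eps)
       (fun beta => cls (rho_eps f eps beta)) /\
     (forall x, R_nat f eps x -> R_sphere (restrict x)) /\
     (forall beta,
        pillow_immersion_at (fun b => restrict (cls (rho_eps f eps b))) beta) /\
     (forall y, (exists x, R_nat f eps x /\ restrict x = y) <->
        exists beta, y = pillow (beta + eps * f beta + PI / 2)
                                (beta - eps * f beta + PI / 2)))
  /\
  (forall x, R_lim f x -> R_nat f 0 x)
  /\
  (forall x, R_lim f x <->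
     exists gamma tau, 0 <= gamma <= PI /\ 0 <= tau <= 2 * PI /\
       (cyl_rep gamma tau th = qj \/ cyl_rep gamma tau th = qopp qj) /\
       x = cls (cyl_rep gamma tau))
  /\
  (forall x, R_lim f x <->
     exists gamma tau, 0 <= gamma <= PI /\ (tau = 0 \/ tau = PI) /\
       x = cls (cyl_rep gamma tau))
  /\
  (exists phi : R -> conj_class tgen,
     (forall beta,
        class_lim0 tangle_rels (fun eps => cls (rho_eps f eps beta)) (phi beta)) /\
     circle_param tangle_rels (R_lim f) phi /\
     (forall beta, restrict (phi beta) = pillow (beta + PI / 2) (beta + PI / 2)) /\
     (forall y, (exists x, R_lim f x /\ restrict x = y) <->
        exists t, y = pillow t t) /\
     (forall beta, corner (restrict (phi beta)) <->
        cong2pi (PI / 2) beta \/ cong2pi (3 * PI / 2) beta) /\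
     (forall beta, ~ cong2pi (PI / 2) beta -> ~ cong2pi (3 * PI / 2) beta ->
        pillow_immersion_at (fun b => restrict (phi b)) beta) /\
     (forall y, (exists x, R_lim f x /\ restrict x = y) -> ~ corner y ->
        exists x1 x2, x1 <> x2 /\
          forall x, (R_lim f x /\ restrict x = y) <-> (x = x1 \/ x = x2))).
Proof.
split; [exists 1; split; [lra|]; intros eps heps; split; [|split; [|split]] |
        split; [|split; [|split]]].
- apply circle_param_rho_eps; trivial; intros x; apply R_natE; trivial.
- intros x hx; apply R_natE in hx; trivial; destruct hx as [b ->].
  rewrite restrict_rho_eps; apply pillow_sphere.
- intros beta; apply restrict_immersion; trivial; apply restrict_not_corner; trivial.
- intros y; split.
  + intros [x [hx <-]]; apply R_natE in hx; trivial; destruct hx as [b ->].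
    exists b; apply restrict_rho_eps.
  + intros [b ->]; exists (cls (rho_eps f eps b)); split; [apply R_natE; eauto|].
    apply restrict_rho_eps.
- intros x hx; apply R_limE in hx; trivial; destruct hx as [b ->].
  exists (rho_eps f 0 b); split; [apply rho_eps_nat_rep, hf | reflexivity].
- intros x; apply R_lim_cyl_h, hf.
- intros x; apply R_lim_cyl, hf.
(* The limit circle is the same formula at e = 0, so the lemmas on circles, restriction and
   immersion apply again. *)
- exists (fun b => cls (rho_eps f 0 b)).
  split; [intros b; apply rho_eps_lim, hf|].
  split; [apply circle_param_rho_eps; trivial; intros x; apply R_limE, hf|].
  split; [intros b; apply restrict_rho_0|].
  split; [|split; [intros b; apply corner_restrict_0|split]].
  + intros y; split.
    * intros [x [hx <-]]; apply R_limE in hx; trivial; destruct hx as [b ->].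
      exists (b + PI / 2); apply restrict_rho_0.
    * intros [t ->]; exists (cls (rho_eps f 0 (t - PI / 2))); split; [apply R_limE; eauto|].
      rewrite restrict_rho_0; f_equal; ring.
  + intros b h1 h2; apply restrict_immersion; trivial.
    intros h; apply corner_restrict_0 in h; tauto.
  + intros y; apply restrict_two_to_one, hf.
Qed.
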